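(* The following statements hold. (1) If $X$ is a non-meager (resp. Baire) open subspace of the product of a family of separable spaces, then $X$ is a g$\mathcal{N}$-space (resp. an $\mathcal{N}$-space). (2) Let $X$ be an open subspace of the product of a family of pseudo-metric spaces; then: (a) $X$ is Baire if and only if $X$ is $\tau$-well $\beta$-défavorable in the sense of Christensen; (b) $X$ is non-meager if and only if $X$ is a g$\mathcal{N}$-space. (3) If $X$ is a separable space and $Y$ a pseudo-metric space such that $X\times Y$ is Baire (resp. non-meager), then $X\times Y$ is an $\mathcal{N}$-space (resp. a g$\mathcal{N}$-space). (4) If $X$ is a space which has countable tightness and a rich family of Baire subspaces, then $X$ is an $\mathcal{N}$-space. (5) Let $X=\prod_{\alpha\in A}X_\alpha$, where each factor is a separable space. If $\prod_{\alpha\in A'}X_\alpha$ is a Baire (resp. non-meager) space for each countable set $A'\subset A$, then $X$ is a Baire $\mathcal{N}$-space (resp. a non-meager g$\mathcal{N}$-space). (6) If $X=\prod_{i\in I}X_i$ is such that each factor has a countable $\pi$-base, then every tail set having the property of Baire in $X$ is either meager or residual in $X$. (7) Any completely regular g$\mathcal{N}$-space is non-meager in itself; and if $X\times Y$ is completely regular such that each factor is either separable or pseudo-metrizable, then $X\times Y$ is a Baire (resp. non-meager) space if and only if it is an $\mathcal{N}$-space (resp. a g$\mathcal{N}$-space).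
   Context: No separation axioms are assumed for topological spaces unless stated; ''compact'' means that every open cover has a finite subcover (not necessarily Hausdorff). $\mathscr{O}(X)$ is the family of all non-void open subsets of $X$. Products carry the product topology. Category: $A\subseteq X$ is meager in $X$ if it is a countable union of sets whose closures have empty interior; otherwise it is non-meager in $X$; complements of meager sets are residual. $X$ is non-meager if it is non-meager in itself. $X$ is Baire if every non-void open subset is non-meager in $X$. Namioka properties: $f\colon X\times Y\to\mathbb{R}$ is separately continuous if it is continuous in each variable when the other is fixed. $X$ is an $\mathcal{N}$-space if for every compact space $Y$ and every separately continuous $f\colon X\times Y\to\mathbb{R}$ there is a dense set $R\subseteq X$ such that $f$ is (jointly) continuous at each point of $R\times Y$. $X$ is a g$\mathcal{N}$-space (generalized Namioka space) if for every compact space $Y$ and every separately continuous $f\colon X\times Y\to\mathbb{R}$ there is at least one point $x\in X$ such that $f$ is jointly continuous at each point of $\{x\}\times Y$. Game: a $\mathcal{J}_p(X)$-play is a sequence $\{(B_i;A_i,a_i)\}_{i=1}^\infty$ in $\mathscr{O}(X)\times\mathscr{O}(X)\times X$ with $B_i\supseteq A_i\supseteq B_{i+1}$ for all $i$, where Player $\beta$ moves first, Player $\beta$ picks the $B_i$ and Player $\alpha$ picks the pairs $(A_i,a_i)$ alternately (the points $a_i\in X$ are otherwise arbitrary). Player $\alpha$ wins $\tau$-well the play if every subnet of the sequence $\{a_n\}_{n=1}^\infty$ has a cluster point in $\bigcap_{n=1}^\infty A_n$; otherwise Player $\beta$ wins $\tau$-well. A strategy for a player determines each of his moves as a function of the preceding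 moves of the opponent. $X$ is $\tau$-well $\beta$-défavorable (in the sense of Christensen) if Player $\beta$ has no strategy that wins $\tau$-well every play consistent with it. Countable tightness: for each $A\subseteq X$ and $p\in\overline{A}$ there is a countable $C\subseteq A$ with $p\in\overline{C}$. Rich family: let $\mathcal{S}_{\mathrm{cl}}(X)$ be the family of non-void closed separable subspaces of $X$. A subfamily $\mathcal{F}\subseteq\mathcal{S}_{\mathrm{cl}}(X)$ is a rich family for $X$ if every $A\in\mathcal{S}_{\mathrm{cl}}(X)$ is contained in some $F\in\mathcal{F}$, and $\overline{\bigcup_{n}F_n}\in\mathcal{F}$ for every increasing sequence $\{F_n\}_{n=1}^\infty$ in $\mathcal{F}$. It is a rich family of Baire subspaces if each member is a Baire space in the subspace topology. A $\pi$-base for $X$ is a family $\mathcal{B}\subseteq\mathscr{O}(X)$ such that every $U\in\mathscr{O}(X)$ contains some member of $\mathcal{B}$. A set $E\subset\prod_{i\in I}X_i$ is a tail set if whenever $x=(x_i)$ and $y=(y_i)$ are points of the product with $x_i=y_i$ for all but finitely many $i$, then $E$ contains both $x$ and $y$ or neither. $E\subseteq X$ has the property of Baire if $E=G\vartriangle P$ with $G$ open and $P$ meager in $X$, where $\vartriangle$ denotes symmetric difference. $X$ is completely regular (not necessarily $T_1$) if for all $x\in X$ and every neighborhood $U$ of $x$ there is a continuous $f\colon X\to[0,1]$ with $f(x)=0$ and $f\equiv1$ on $X\setminus U$. *)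

(* Defs.v *)
From HB Require Import structures.
From mathcomp Require Import all_boot all_order all_algebra.
From mathcomp Require Import all_classical all_reals all_analysis.

Set Implicit Arguments.
Unset Strict Implicit.
Unset Printing Implicit Defensive.

Import Order.TTheory GRing.Theory Num.Theory.
Import numFieldNormedType.Exports.

Local Open Scope classical_set_scope.
Local Open Scope ring_scope.

(* Subspaces are the types [set_type A] with the initial topology of the
   inclusion, so that notions about spaces apply to them directly; [subspace A]
   would keep the points outside [A] as isolated points. *)

Definition nonvoid_open (X : topologicalType) : set (set X) :=
  [set U | open U /\ U !=set0].

Definition separable (X : topologicalType) :=
  exists2 C : set X, countable C & dense C.

Definition meager (X : topologicalType) (A : set X) :=
  exists F : nat -> set X,
    (forall n, interior (closure (F n)) = set0) /\ A = \bigcup_n F n.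

Definition residual (X : topologicalType) (A : set X) := meager (~` A).

Definition nonmeager_space (X : topologicalType) := ~ meager [set: X].

Definition baire_space (X : topologicalType) :=
  forall U : set X, nonvoid_open U -> ~ meager U.

Definition property_of_Baire (X : topologicalType) (E : set X) :=
  exists G P : set X, [/\ open G, meager P & E = G `+` P].

Definition separately_continuous (R : realType) (X Y : topologicalType)
    (f : X * Y -> R) :=
  (forall y, continuous (fun x => f (x, y))) /\
  (forall x, continuous (fun y => f (x, y))).

(* [cover_compact] is the open cover definition; no point is required in [Y]. *)
Definition N_space (R : realType) (X : topologicalType) :=
  forall Y : topologicalType, cover_compact [set: Y] ->
  forall f : X * Y -> R, separately_continuous f ->
  exists D : set X, dense D /\
    forall x y, D x -> {for (x, y), continuous f}.

Definition gN_space (R : realType) (X : topologicalType) :=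
  forall Y : topologicalType, cover_compact [set: Y] ->
  forall f : X * Y -> R, separately_continuous f ->
  exists x : X, forall y, {for (x, y), continuous f}.

Definition directed (D : Type) (le : D -> D -> Prop) :=
  [/\ inhabited D, forall d, le d d,
      forall d e f, le d e -> le e f -> le d f
    & forall d e, exists f, le d f /\ le e f].

Definition net_cluster (X : topologicalType) (D : Type) (le : D -> D -> Prop)
    (x : D -> X) (p : X) :=
  forall U, nbhs p U -> forall d, exists e, le d e /\ U (x e).

(* The reindexing of a subnet is eventually beyond each [n], but need not be
   monotone (subnets in the sense of Kelley). *)
Definition subnet_index (D : Type) (le : D -> D -> Prop) (phi : D -> nat) :=
  directed le /\ forall n, exists d, forall e, le d e -> (n <= phi e)%N.

Section game.
Variable X : topologicalType.

Definition J_play (B A : nat -> set X) (a : nat -> X) :=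
  forall n, [/\ nonvoid_open (B n), nonvoid_open (A n),
                A n `<=` B n & B n.+1 `<=` A n].

Definition alpha_wins_tau_well (A : nat -> set X) (a : nat -> X) :=
  forall (D : Type) (le : D -> D -> Prop) (phi : D -> nat),
  subnet_index le phi ->
  exists2 p, (\bigcap_n A n) p & net_cluster le (a \o phi) p.

(* A strategy for beta maps the list [:: (A_1, a_1); .. ; (A_n, a_n)] of the
   moves already made by alpha to the next move B_{n+1}. *)
Definition beta_map := seq (set X * X) -> set X.

(* The histories that arise when alpha follows the rules against [s]. *)
Inductive history (s : beta_map) : seq (set X * X) -> Prop :=
| history_nil : history s [::]
| history_rcons h A a : history s h -> nonvoid_open A -> A `<=` s h ->
    history s (rcons h (A, a)).

(* A strategy must answer legally; otherwise one with no consistent play at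
   all would be winning. In particular beta has no strategy on a void space. *)
Definition beta_strategy (s : beta_map) :=
  forall h, history s h ->
    nonvoid_open (s h) /\ s h `<=` last [set: X] (unzip1 h).

Definition consistent (s : beta_map) (B A : nat -> set X) (a : nat -> X) :=
  forall n, B n = s (mkseq (fun i => (A i, a i)) n).

Definition tau_well_beta_defavorable :=
  ~ exists s, beta_strategy s /\
      forall B A a, J_play B A a -> consistent s B A a ->
        ~ alpha_wins_tau_well A a.

End game.

Definition countably_tight (X : topologicalType) :=
  forall (A : set X) p, closure A p ->
  exists C : set X, [/\ countable C, C `<=` A & closure C p].

Definition S_cl (X : topologicalType) : set (set X) :=
  [set A | [/\ A !=set0, closed A & separable (set_type A)]].

Definition rich_family (X : topologicalType) (F : set (set X)) :=
  [/\ F `<=` @S_cl X,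
      forall A, S_cl A -> exists2 B, F B & A `<=` B
    & forall G : nat -> set X, (forall n, F (G n)) ->
        (forall n, G n `<=` G n.+1) -> F (closure (\bigcup_n G n))].

Definition pi_base (X : topologicalType) (B : set (set X)) :=
  B `<=` @nonvoid_open X /\
  forall U, nonvoid_open U -> exists2 V, B V & V `<=` U.

Definition tail_set (I : Type) (X : I -> Type) (E : set (forall i, X i)) :=
  forall x y, finite_set [set i | x i <> y i] -> (E x <-> E y).

(* The library's [completely_regular_space] is phrased with uniformities; see
   [uniform_separatorP] for the link. *)
Definition completely_regular (R : realType) (X : topologicalType) :=
  forall (x : X) (U : set X), nbhs x U ->
  exists f : X -> R, [/\ continuous f, range f `<=` `[0, 1], f x = 0
                       & forall y, ~ U y -> f y = 1].

Definition pseudo_metrizable (R : realType) (X : topologicalType) :=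
  exists d : X -> X -> R,
    [/\ forall x y, 0 <= d x y, forall x, d x x = 0,
        forall x y, d x y = d y x, forall x y z, d x z <= d x y + d y z
      & forall x, nbhs x = nbhs_ball_ (fun y e => [set z | d y z < e]) x].

(* Main.v *)
Require Import Defs.
From HB Require Import structures.
From mathcomp Require Import all_boot all_order all_algebra.
From mathcomp Require Import all_classical all_reals all_analysis.
From mathcomp Require Import finmap lra.

Set Implicit Arguments.
Unset Strict Implicit.
Unset Printing Implicit Defensive.

Import Order.TTheory GRing.Theory Num.Theory.
Import numFieldNormedType.Exports.

(** Let [f] be separately continuous on [X * Y] with [Y] compact. Then [f] is
continuous at all points of [{x} * Y] as soon as, for every [e > 0], the
functions [f (x', _)] with [x'] near [x] differ uniformly by at most [e]
([small_osc_continuous]). The points [x] with this property for a fixed [e]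
form an open set, so that, by category, both Namioka properties reduce to one
fact: every nonmeager open set [W] contains such a point.

This fact is proved with a game of nested open sets, in which one player also
marks countably many points at each move. Assume that the oscillation exceeds
[e] throughout [W]. Compactness of [Y] then lets the other player answer with
two points [y], [y'] of [Y] which the functions [f (a, _)] hardly separate, for
the finitely many marked points [a] taken into account so far, and with the
open set of all [x] such that [f (x, y)] and [f (x, y')] are far apart
([separating_pair]). In the limit the two points of [Y] agree on all marked
points but not on the intersection of the open sets. This is absurd if the
marking player can force the marked points to accumulate at a point of this
intersection, which is what [has_tracking_tactic] says. As [W] is only
nonmeager, plays that have nonempty intersection are found by Oxtoby's
argument with maximal disjoint families of positions ([oxtoby_play]).

A separable space has such a tactic (mark a dense sequence), and so has a
pseudometric space (play small sets and mark one of their points). In both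
cases the tactic is positional, and it passes to arbitrary products and to
their open subspaces: only finitely many coordinates are restricted at a time,
and the others are filled in with those of a fixed base point
([product_tracking_tactic]). For pseudometric factors a single point is marked
at each move, and the marked points converge to the limit point along the
whole sequence. Hence, in a Baire space, every strategy of beta in the game of
Christensen loses some play ([tracking_tactic_tau_well]), whereas in a space
that is not Baire beta wins by avoiding nowhere dense sets ([tau_well_baire]).

Conversely, let [X] be completely regular and let [F] be a sequence of nowhere
dense sets. Disjointly supported bump functions that vanish on the [F n],
indexed by the one-point compactification of a discrete set, form a separately
continuous function which is discontinuous above every point of the union of
the [F n] ([nowhere_continuous_on]). So Namioka properties imply category
properties.

With countable tightness and a rich family, one builds a separable member of
the family that contains enough points to inherit both a large oscillation and
a failure of the Baire property ([rich_trace]). For a product of separable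
spaces, countably many nowhere dense sets are described, up to density, by
boxes supported by countably many coordinates ([countable_support]), so that
meagerness of an open set is seen in a countable subproduct. The zero-one law
is a Kuratowski-Ulam argument: a tail set and a box depend on disjoint sets of
coordinates, and the finitely many coordinates of the box have countable
pi-bases ([tail_residual]). *)

Local Open Scope classical_set_scope.
Local Open Scope ring_scope.

(** * Meager sets *)

(** Maximality in the form in which it yields density of unions. *)
Lemma maximal_disjoint_meets I T (F : I -> set T) (E D : set I) i :
  maximal_disjoint_subcollection F E D -> D i -> F i !=set0 ->
  exists2 j, E j & F j `&` F i !=set0.
Proof.
move=> [ED tE maxE] Di [x Fx]; apply: contrapT => nE.
have dis j y : E j -> F j y -> F i y -> False.
  by move=> Ej Fj Fi; apply: nE; exists j => //; exists y.
apply: (maxE (E `|` [set i])).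
- split; first by move=> ?; left.
  by move=> /(_ i) Ei; apply: (dis i x) => //; apply: Ei; right.
- by move=> j [/ED//|->].
- move=> j k [Ej|->] [Ek|->] // [y [Fj Fk]].
  + by apply: tE => //; exists y.
  + by have := dis _ _ Ej Fj Fk.
  + by have := dis _ _ Ek Fk Fj.
Qed.

Section category.
Variable X : topologicalType.
Implicit Types A B U V G : set X.

Definition nowhere_dense A := interior (closure A) = set0.

Lemma notin_closure_open A V x :
  open V -> (forall y, V y -> ~ A y) -> V x -> ~ closure A x.
Proof.
by move=> oV VA Vx /(_ _ (open_nbhs_nbhs (conj oV Vx)))[y [/[swap] /VA]].
Qed.

Lemma nowhere_denseP A : nowhere_dense A <->
  forall U, nonvoid_open U ->
    exists V, [/\ nonvoid_open V, V `<=` U & forall x, V x -> ~ A x].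
Proof.
split=> [A0 U [oU [x Ux]]|H].
  have [UA|/existsNP[y /not_implyP[Uy nAy]]] := pselect (U `<=` closure A).
    have : interior (closure A) x by apply: filterS UA (open_nbhs_nbhs (conj oU Ux)).
    by rewrite A0.
  exists (U `&` ~` closure A); split.
  - by split; [apply: openI => //; exact/closed_openC/closed_closure|exists y].
  - by move=> z [].
  - by move=> z [_ nz] Az; apply: nz; exact: subset_closure.
rewrite /nowhere_dense -subset0 => x xA.
have [|V [[oV [y Vy]] VU VA]] := H (interior (closure A)).
  by split; [exact: open_interior|exists x].
exact: (notin_closure_open oV VA Vy) (interior_subset (VU _ Vy)).
Qed.

Lemma nowhere_denseS A B : A `<=` B -> nowhere_dense B -> nowhere_dense A.
Proof.
move=> AB /nowhere_denseP B0; apply/nowhere_denseP => U /B0[V [oV VU VB]].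
by exists V; split=> // x /VB nB /AB.
Qed.

(** The pieces of a meager set may be taken larger than the set. *)
Lemma meagerP A :
  meager A <-> exists F : nat -> set X, (forall n, nowhere_dense (F n)) /\ A `<=` \bigcup_n F n.
Proof.
split=> [[F [F0 ->]]|[F [F0 AF]]]; first by exists F; split.
exists (fun n => A `&` F n); split=> [n|].
  exact: nowhere_denseS (@subIsetr _ _ _) (F0 n).
by rewrite -setI_bigcupr setIidl.
Qed.

Lemma meagerS A B : A `<=` B -> meager B -> meager A.
Proof.
move=> AB /meagerP[F [F0 BF]]; apply/meagerP; exists F; split=> //.
exact: subset_trans BF.
Qed.

Lemma meager_bigcup (F : nat -> set X) :
  (forall n, meager (F n)) -> meager (\bigcup_n F n).
Proof.
move=> mF; have [G G0] := choice (fun n => (meagerP (F n)).1 (mF n)).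
apply/meagerP; exists (fun k => if choice.unpickle k is Some (n, m) then G n m else set0).
split=> [k|x [n _ Fx]].
  case: (choice.unpickle k) => [[n m]|]; first exact: (G0 n).1.
  by apply/nowhere_denseP => U oU; exists U; split=> // x _ [].
by have [m _ Gx] := (G0 n).2 _ Fx; exists (choice.pickle (n, m)) => //; rewrite choice.pickleK.
Qed.

Lemma meagerU A B : meager A -> meager B -> meager (A `|` B).
Proof.
move=> mA mB; have : meager (\bigcup_n if n is 0%N then A else B).
  by apply: meager_bigcup; case.
by apply: meagerS => x [] ?; [exists 0%N|exists 1%N].
Qed.

Lemma nowhere_dense_meager A : nowhere_dense A -> meager A.
Proof. by move=> A0; apply/meagerP; exists (fun=> A); split=> // x; exists 0%N. Qed.

Lemma nonmeager_nonempty A : ~ meager A -> A !=set0.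
Proof.
move=> nA; apply: contrapT => /nonemptyPn A0; apply: nA; rewrite A0.
by apply: nowhere_dense_meager; rewrite /nowhere_dense closure0 interior0.
Qed.

Lemma nowhere_denseD U G : open U -> open G ->
  (forall V, nonvoid_open V -> V `<=` U -> V `&` G !=set0) ->
  nowhere_dense (U `\` G).
Proof.
move=> oU oG dG; apply/nowhere_denseP => V [oV V0].
have [[x VUx]|/nonemptyPn VU0] := pselect (V `&` U !=set0).
  have [||y [[Vy Uy] Gy]] := dG (V `&` U).
  - by split; [exact: openI|exists x].
  - by move=> ? [].
  exists (V `&` G); split.
  - by split; [exact: openI|exists y].
  - by move=> ? [].
  - by move=> z [_ Gz] [_].
exists V; split=> // x Vx [Ux _].
by have : (V `&` U) x by []; rewrite VU0.
Qed.

End category.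

Section banach.
Variable X : topologicalType.

(** The Banach category theorem. For a maximal disjoint family of meager open
members of [B] in [G], the union over the family of the [n]th pieces is
nowhere dense, since an open set that meets one member [W] can be shrunk into
[W], where only the piece of [W] matters. *)
Lemma meager_of_local (G : set X) (B : set (set X)) : open G ->
  (forall V, nonvoid_open V -> V `<=` G ->
     exists W, [/\ B W, nonvoid_open W & W `<=` V]) ->
  (forall W, B W -> nonvoid_open W -> W `<=` G -> meager W) -> meager G.
Proof.
move=> oG dB mB.
pose D := [set W | [/\ B W, nonvoid_open W & W `<=` G]].
have [E maxE] := ex_maximal_disjoint_subcollection (id : set X -> set X) D.
have [ED tE _] := maxE.
have /choice[N NP] : forall W, exists N : nat -> set X, E W ->
    (forall n, nowhere_dense (N n)) /\ W = \bigcup_n N n.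
  move=> W; have [EW|nEW] := pselect (E W); last by exists (fun=> set0).
  by have [BW oW WG] := ED _ EW; have [N NW] := mB W BW oW WG; exists N.
pose U := \bigcup_(W in E) W.
have oU : open U by apply: bigcup_open => W /ED[_ []].
apply: (@meagerS _ _ ((G `\` U) `|` \bigcup_n \bigcup_(W in E) N W n)).
  move=> x Gx; have [Ux|nUx] := pselect (U x); [right|by left].
  have [W EW Wx] := Ux; have [_ WE] := NP W EW; rewrite WE in Wx.
  by have [n _ Nx] := Wx; exists n => //; exists W.
apply: meagerU.
  apply: nowhere_dense_meager; apply: nowhere_denseD => // V oV VG.
  have [W [BW oW WV]] := dB V oV VG.
  have DW : D W by split=> //; exact: subset_trans VG.
  have [W' EW' [x [W'x Wx]]] := maximal_disjoint_meets maxE DW oW.2.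
  by exists x; split; [exact: WV|exists W'].
apply/meagerP; exists (fun n => \bigcup_(W in E) N W n); split=> // n.
apply/nowhere_denseP => V [oV V0].
have [[x [Vx [W EW Wx]]]|VU] := pselect (V `&` U !=set0); last first.
  exists V; split=> // x Vx [W EW Nx]; apply: VU; exists x; split=> //.
  by exists W => //; have [_ ->] := NP W EW; exists n.
have [_ [oW _] _] := ED _ EW.
have [/(_ n)/nowhere_denseP N0 _] := NP W EW.
have [|V' [oV' V'V V'N]] := N0 (V `&` W).
  by split; [exact: openI|exists x].
exists V'; split=> //; first by move=> y /V'V[].
move=> y V'y [W' EW' Ny]; have [_ Wy] := V'V _ V'y.
suff WW' : W' = W by apply: (V'N y V'y); rewrite -WW'.
apply: tE => //; exists y; split=> //.
by have [_ ->] := NP W' EW'; exists n.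
Qed.

End banach.

(** * Plays of the open set game through a given nonmeager set *)

Section oxtoby.
Variables (X : topologicalType) (M : Type) (A : M -> set X).
Variables (s : seq M -> set X) (ok : seq M -> M -> Prop).

(** The positions of a game in which one player makes moves [m] of type [M]
and the other answers a list of moves [h] with the open set [s h]. The first
player must play [A m] inside the last answer and obey the rule [ok]. *)
Inductive legal : seq M -> Prop :=
| legal_nil : legal [::]
| legal_rcons h m : legal h -> ok h m -> A m `<=` s h -> legal (rcons h m).

Hypothesis s_open : forall h, legal h -> nonvoid_open (s h).
Hypothesis s_sub : forall h m, legal (rcons h m) -> s (rcons h m) `<=` A m.
Hypothesis ok_ex : forall h V, legal h -> nonvoid_open V -> V `<=` s h ->
  exists m, ok h m /\ A m `<=` V.

Let moves h := [set m | ok h m /\ A m `<=` s h].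

Let E h : set M := projT1
  (ex_maximal_disjoint_subcollection (fun m => s (rcons h m)) (moves h)).

Let EP h : maximal_disjoint_subcollection (fun m => s (rcons h m)) (E h) (moves h).
Proof. by rewrite /E; case: (ex_maximal_disjoint_subcollection _ _). Qed.

Let legalE h m : legal h -> E h m -> legal (rcons h m).
Proof. by move=> lh Em; have [/(_ _ Em)[okm Am] _ _] := EP h; exact: legal_rcons. Qed.

Let subE h m : legal h -> E h m -> s (rcons h m) `<=` s h.
Proof.
move=> lh Em; have [/(_ _ Em)[okm Am] _ _] := EP h.
by apply: subset_trans Am; apply: s_sub; exact: legalE.
Qed.

Let E_dense h V : legal h -> nonvoid_open V -> V `<=` s h ->
  exists2 m, E h m & V `&` s (rcons h m) !=set0.
Proof.
move=> lh oV Vs; have [m [okm AmV]] := ok_ex lh oV Vs.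
have mm : moves h m by split=> //; exact: subset_trans Vs.
have lm : legal (rcons h m) by apply: legal_rcons => //; case: mm.
have [k Ek [x [sk sm]]] := maximal_disjoint_meets (EP h) mm (s_open lm).2.
by exists k => //; exists x; split=> //; apply: AmV; exact: s_sub sm.
Qed.

(** Any two positions of [H n] have disjoint answers, and the union of the
   answers is dense in the first one. *)
Let Fixpoint H n : set (seq M) :=
  if n is n'.+1 then [set h | exists h' m, [/\ H n' h', E h' m & h = rcons h' m]]
  else [set [::]].

Let H_legal n h : H n h -> legal h.
Proof.
elim: n h => [h ->|n IH h [h' [m [/IH lh' Em ->]]]]; first exact: legal_nil.
exact: legalE.
Qed.

(** A point lies in the answer to at most one position of each length: it
   determines a branch of the tree of positions. *)
Let H_inj n h h' x : H n h -> H n h' -> s h x -> s h' x -> h = h'.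
Proof.
elim: n h h' => [h h' -> ->//|n IH h0 h0'].
move=> [h [m [Hh Em ->]]] [h' [m' [Hh' Em' ->]]] sx sx'.
have e : h = h'.
  by apply: IH => //; [exact: subE (H_legal Hh) Em _ sx
                      |exact: subE (H_legal Hh') Em' _ sx'].
rewrite -e in Em' sx' *; have [_ tE _] := EP h.
by rewrite (tE m m') //; exists x.
Qed.

Let G n := \bigcup_(h in H n) s h.

Let G_open n : open (G n).
Proof. by apply: bigcup_open => h /H_legal/s_open[]. Qed.

Let G_dense n V : nonvoid_open V -> V `<=` s [::] -> V `&` G n !=set0.
Proof.
elim: n V => [|n IH] V oV Vs.
  have [_ [x Vx]] := oV; exists x; split=> //; exists [::] => //; exact: Vs.
have [x [Vx [h Hh sx]]] := IH _ oV Vs.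
have [||m Em [y [[Vy _] sy]]] := @E_dense h (V `&` s h) (H_legal Hh).
- split; last by exists x.
  by apply: openI; [case: oV|case: (s_open (H_legal Hh))].
- by move=> ? [].
by exists y; split=> //; exists (rcons h m) => //; exists h, m.
Qed.

(** The dense open unions of the levels of the tree have a common point in a
nonmeager set, and the branch determined by this point is the play. *)
Lemma oxtoby_play : ~ meager (s [::]) -> exists (m : nat -> M) (x : X),
  forall n, [/\ ok (mkseq m n) (m n), A (m n) `<=` s (mkseq m n)
              & s (mkseq m n) x].
Proof.
move=> nm.
have [x [sx Gx]] : exists x, s [::] x /\ forall n, G n x.
  apply: contrapT => nx; apply: nm; apply/meagerP.
  exists (fun n => s [::] `\` G n); split=> [n|x sx].
    apply: nowhere_denseD => //; last exact: G_dense.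
    by have [] := s_open legal_nil.
  apply: contrapT => nU; apply: nx; exists x; split=> // n.
  by apply: contrapT => nG; apply: nU; exists n.
pose P h := (exists n, H n h) /\ s h x.
pose S := {h | P h}.
have step (h : S) : {h' : S | exists m, E (sval h) m /\ sval h' = rcons (sval h) m}.
  apply: cid; case: h => h [[n Hh] sh] /=.
  have [_ [h1 [m [Hh1 Em ->]]] s1] := Gx n.+1.
  have e : h1 = h by apply: (H_inj Hh1 Hh _ sh); exact: subE (H_legal Hh1) Em _ s1.
  rewrite e in Hh1 Em s1.
  have Hm : P (rcons h m).
    by split=> //; exists n.+1, h, m.
  by exists (exist _ _ Hm), m.
have H0 : P [::] by split=> //; exists 0%N.
have [f [f0 fS]] := dependent_choice step (exist _ _ H0).
have [m mP] := choice fS.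
have fE n : sval (f n) = mkseq m n.
  by elim: n => [|n IH]; rewrite ?f0 // mkseqS -IH; case: (mP n).
exists m, x => n; have [+ _] := mP n; rewrite fE => Em.
have [/(_ _ Em)[okm Am] _ _] := EP (mkseq m n); split=> //.
by rewrite -fE; case: (f n) => ? [].
Qed.

End oxtoby.

(** The moves [m] come with an open set [A m] and a sequence [pts m] of marked
points. The last clause says that a play with nonempty intersection has a
point [q] in this intersection at which the marked points accumulate; [q] need
not be the given point [p], since the coordinates of [p] that were never
restricted must be changed in a product. When [single] holds, only one point
is marked by each move. *)
Definition has_tracking_tactic (single : bool) (Z : topologicalType) :=
  exists (M : Type) (A : M -> set Z) (pts : M -> nat -> Z)
    (ok : seq M -> M -> Prop),
  [/\ single -> forall m k, pts m k = pts m 0%N,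
      forall h V, nonvoid_open V ->
        exists m, [/\ ok h m, nonvoid_open (A m) & A m `<=` V]
    & forall (m : nat -> M) p, (forall n, ok (mkseq m n) (m n)) ->
        (forall n, A (m n) p) ->
        exists q, (forall n, A (m n) q) /\ forall U, nbhs q U ->
          exists N, forall n, (N <= n)%N -> exists k, U (pts (m n) k)].

(** * Oscillation of separately continuous functions *)

Lemma filter_forall_seq (I : eqType) T (F : set_system T) (s : seq I)
    (P : I -> set T) : Filter F ->
  (forall i, i \in s -> F (P i)) -> F [set x | forall i, i \in s -> P i x].
Proof.
move=> FF; elim: s => [_|i s IH sP]; first by apply: filterS filterT.
have Fi : F (P i) by apply: sP; rewrite mem_head.
have Fs : F [set x | forall i, i \in s -> P i x].
  by apply: IH => j js; apply: sP; rewrite inE js orbT.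
by apply: filterS2 Fi Fs => x Pi Ps j; rewrite inE => /predU1P[->//|/Ps].
Qed.

(** Otherwise finitely many open sets that are not in [F] cover [Y]. *)
Lemma ultra_limit (Y : topologicalType) (F : set_system nat) (u : nat -> Y) :
  cover_compact [set: Y] -> UltraFilter F -> exists y : Y, u @ F --> y.
Proof.
move=> cY FU; have FF := @ultra_proper _ _ FU; apply: contrapT => nlim.
have /choice [G GP] : forall y, exists G0, [/\ open G0, G0 y & F (u @^-1` (~` G0))].
  move=> y; have [B [yB nB]] : exists B, nbhs y B /\ ~ F (u @^-1` B).
    apply: contrapT => /forallNP nB; apply: nlim; exists y => B yB.
    by apply: contrapT => FB; exact: (nB B).
  exists (interior B); split => //; first exact: open_interior.
  have [FB|//] := in_ultra_setVsetC (u @^-1` interior B) FU.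
  by exfalso; apply: nB; apply: filterS FB => n; exact: interior_subset.
have [|y _|D' _ cD] := cY Y setT G; first by move=> y _; case: (GP y).
  by exists y => //; case: (GP y).
have : F (\bigcap_(y in [set` D']) u @^-1` (~` G y)).
  by apply: filter_bigI => y _; case: (GP y).
move=> /filter_ex[n nO]; have [y yD Gy] := cD (u n) I.
exact: nO _ yD Gy.
Qed.

Lemma eventually_invn_lt (R : realType) (e : R) : 0 < e ->
  exists N, forall n, (N <= n)%N -> n.+1%:R^-1 < e.
Proof. by move=> e0; have [N _ NP] := near_infty_natSinv_lt (PosNum e0); exists N. Qed.

Section oscillation.
Variables (R : realType) (Z Y : topologicalType) (f : Z * Y -> R).

Definition small_osc (e : R) : set Z := [set x | exists2 V, nbhs x V &
  forall x1 x2 y, V x1 -> V x2 -> `|f (x1, y) - f (x2, y)| <= e].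

Lemma open_small_osc e : open (small_osc e).
Proof.
rewrite openE => x [V xV VP]; rewrite /interior.
by apply: filterS (nbhs_interior xV) => z zV; exists V.
Qed.

Lemma small_osc_continuous x : (forall y, continuous (fun x => f (x, y))) ->
  (forall x, continuous (fun y => f (x, y))) ->
  (forall n : nat, small_osc n.+1%:R^-1 x) ->
  forall y, {for (x, y), continuous f}.
Proof.
move=> fX fY xo y; apply/cvgrPdist_lt => e e0.
have e20 : 0 < e / 2 by rewrite divr_gt0.
have [n /(_ n (leqnn _)) ne] := eventually_invn_lt e20.
have [V xV VP] := xo n.
have /cvgrPdist_lt/(_ (e / 2)) := fY x y.
move=> /(_ e20) yV.
exists (V, [set y' | `|f (x, y) - f (x, y')| < e / 2]) => //.
move=> [x' y'] /= [Vx' Vy']; have Vx := nbhs_singleton xV.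
have -> : f (x, y) - f (x', y') = (f (x, y) - f (x, y')) + (f (x, y') - f (x', y')).
  by rewrite addrA subrK.
apply: le_lt_trans (ler_normD _ _) _; rewrite (splitr e) ltrD //.
exact: le_lt_trans (VP _ _ y' Vx Vx') ne.
Qed.

Hypothesis cY : cover_compact [set: Y].
Hypothesis fX : forall y, continuous (fun x => f (x, y)).
Hypothesis fY : forall x, continuous (fun y => f (x, y)).

Lemma gap_continuous y y' : continuous (fun x => `|f (x, y) - f (x, y')|).
Proof. by move=> x; apply: cvg_norm; apply: cvgB; exact: (@fX _ x). Qed.

Lemma open_gap y y' (e : R) : open [set x | e < `|f (x, y) - f (x, y')|].
Proof.
by have /continuousP/(_ _ (@open_gt R e)) := @gap_continuous y y'.
Qed.

(** Otherwise, on [V], the values [f (z, y)] are determined up to [e / 4] by the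
values [f (a, y)] for [a] in [E]. By compactness finitely many [y] represent all
of them, and continuity of [f] in its first variable at these [y] makes the
oscillation at most [4 * (e / 4)]. *)
Lemma separating_pair (V : set Z) (E : seq Z) (e d : R) : 0 < e -> 0 < d ->
  nonvoid_open V -> (forall x, V x -> ~ small_osc e x) ->
  exists x yy, [/\ V x, forall a, a \in E -> `|f (a, yy.1) - f (a, yy.2)| < d
    & e / 4 < `|f (x, yy.1) - f (x, yy.2)| ].
Proof.
move=> e0 d0 [oV [x Vx]] Ve; apply: contrapT => nsep.
have close z y y' : V z -> (forall a, a \in E -> `|f (a, y) - f (a, y')| < d) ->
    `|f (z, y) - f (z, y')| <= e / 4.
  move=> Vz yy'; rewrite leNgt; apply/negP => lt.
  by apply: nsep; exists z, (y, y').
have [||D' _ cD] := cY (D := setT)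
    (f := fun y => interior [set y' | forall a, a \in E -> `|f (a, y) - f (a, y')| < d]).
- by move=> y _; exact: open_interior.
- move=> y _; exists y => //; rewrite /interior /=.
  apply: filter_forall_seq => a _.
  by have /cvgrPdist_lt/(_ _ d0) := @fY a y.
have e40 : 0 < e / 4 by rewrite divr_gt0.
apply: (Ve x Vx); exists (V `&` \bigcap_(y in [set` D'])
    [set z | `|f (x, y) - f (z, y)| < e / 4]).
  apply: filterI; first exact: open_nbhs_nbhs.
  apply: filter_bigI => y _.
  by have /cvgrPdist_lt/(_ _ e40) := @fX y x.
move=> x1 x2 y [V1 D1] [V2 D2].
have [y' y'D /interior_subset yy'] := cD y I.
have /= := D1 y' y'D; have /= := D2 y' y'D.
have := close _ _ _ V1 yy'; have := close _ _ _ V2 yy'.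
by rewrite !ler_distl !ltr_distl; lra.
Qed.

(** If the oscillation is large throughout [W], answering with the sets on which
a separating pair stays separated is a strategy that keeps every accumulation
point of the marked points out of the intersection. *)
Lemma small_osc_nonmeager single (W : set Z) (e : R) : has_tracking_tactic single Z ->
  0 < e -> open W -> ~ meager W -> W `&` small_osc e !=set0.
Proof.
move=> [M [A [pts [ok [_ okex okP]]]]] e0 oW nW; apply: contrapT => /nonemptyPn We.
have Wbad x : W x -> ~ small_osc e x.
  by move=> Wx ox; have : (W `&` small_osc e) x by []; rewrite We.
pose cur h := last W (map A h).
(* After [n] moves the first [n] marks of each of these moves are taken into
   account, so that every mark is considered from some move on. *)
pose E h := [seq pts m k | m <- h, k <- iota 0 (size h)].
pose Q (h : seq M) x (yy : Y * Y) := [/\ cur h x,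
  forall a, a \in E h -> `|f (a, yy.1) - f (a, yy.2)| < (size h).+1%:R^-1
  & e / 4 < `|f (x, yy.1) - f (x, yy.2)| ].
have [w Ww] := nonmeager_nonempty nW.
have [_ [yy0 _]] : exists x yy, Q [::] x yy.
  by apply: separating_pair => //; split=> //; exists w.
have /choice [yy yyP] : forall h, exists yy, (exists x yy', Q h x yy') -> exists x, Q h x yy.
  move=> h; have [[x [yy' xy]]|nq] := pselect (exists x yy', Q h x yy').
    by exists yy' => _; exists x.
  by exists yy0.
pose s h := if h is [::] then W else
  cur h `&` [set x | e / 4 < `|f (x, (yy h).1) - f (x, (yy h).2)|].
have s_cur h : s h `<=` cur h by case: h => // m h x [].
pose ok' h m := ok h m /\ nonvoid_open (A m).
have curP h : legal A s ok' h -> nonvoid_open (cur h) /\ cur h `<=` W.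
  elim => [|{}h m _ [_ hW] [_ oA] As]; first by split=> //; split=> //; exists w.
  rewrite /cur map_rcons last_rcons; split=> //.
  by apply: subset_trans hW; exact: subset_trans (s_cur h).
have pickP h : legal A s ok' h -> exists x, Q h x (yy h).
  move=> /curP[oc cW]; apply: yyP.
  by apply: separating_pair => // x /cW /Wbad.
have [h lh|h m _|h V lh oV _||m [p mP]] := @oxtoby_play Z M A s ok'.
- have [oc cW] := curP _ lh; have [x [cx _ sx]] := pickP _ lh.
  split; last by exists x; case: (h) cx sx.
  case: (h) oc => [//|m h'] oc; apply: openI; first by case: oc.
  exact: open_gap.
- by apply: subset_trans (s_cur _) _; rewrite /cur map_rcons last_rcons.
- by have [m [okm oA AV]] := okex h V oV; exists m.
- exact: nW.
have lm n : legal A s ok' (mkseq m n).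
  elim: n => [|n IH]; first exact: legal_nil.
  by rewrite mkseqS; have [okm Am _] := mP n; exact: legal_rcons.
have [q [Aq qP]] : exists q, (forall n, A (m n) q) /\ forall U, nbhs q U ->
          exists N, forall n, (N <= n)%N -> exists k, U (pts (m n) k).
  apply: (okP m p) => n; first by have [[]] := mP n.
  have [_ _ /s_cur] := mP n.+1.
  by rewrite /cur mkseqS map_rcons last_rcons.
(* An ultrafilter makes both sequences of points of [Y] converge at once. *)
have [F [FU ooF]] := ultraFilterLemma (eventually_filter : ProperFilter \oo).
have FF := @ultra_proper _ _ FU.
pose yn n := yy (mkseq m n.+1).
have [y1 y1P] := ultra_limit (fst \o yn) cY FU.
have [y2 y2P] := ultra_limit (snd \o yn) cY FU.
pose g z := `|f (z, y1) - f (z, y2)|.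
have gP z : (fun n => `|f (z, (yn n).1) - f (z, (yn n).2)|) @ F --> g z.
  apply: cvg_norm; apply: cvgB.
    exact: (@cvg_comp _ _ _ (fst \o yn) (fun y => f (z, y)) _ _ _ y1P (@fY z y1)).
  exact: (@cvg_comp _ _ _ (snd \o yn) (fun y => f (z, y)) _ _ _ y2P (@fY z y2)).
have g0 n k : g (pts (m n) k) = 0.
  apply/eqP; rewrite eq_le normr_ge0 andbT; apply/ler_addgt0Pr => d d0; rewrite add0r.
  have := @closed_cvg _ R F FF _ (fun r => r <= d) (@closed_le R d).
  move=> /(_ _ _ _ (gP _)); apply.
  have [N NP] := eventually_invn_lt d0.
  apply: ooF; exists (maxn N (maxn n.+1 k.+1)) => // i /=.
  rewrite !geq_max => /and3P[Ni ni ki].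
  have [_ [_ close _]] := pickP _ (lm i.+1).
  apply/ltW; apply: lt_trans (close _ _) _.
    apply/flattenP; exists [seq pts (m n) k' | k' <- iota 0 (size (mkseq m i.+1))].
      by rewrite /mkseq -map_comp; apply/mapP; exists n => //; rewrite mem_iota /= add0n ltnS ltnW.
    by apply: map_f; rewrite mem_iota size_mkseq /= add0n ltnS ltnW.
  by rewrite size_mkseq; apply: NP; rewrite (leq_trans Ni).
have gq : e / 4 <= g q.
  have := @closed_cvg _ R F FF _ (fun r => e / 4 <= r) (@closed_ge R _).
  move=> /(_ _ _ _ (gP _)); apply.
  apply: nearW => n.
  have [_ + _] := mP n.+1; move=> /(_ q (Aq _)).
  by rewrite /s /= => -[_ /ltW].
have : nbhs q [set z | 0 < g z].
  apply: open_nbhs_nbhs; split; first exact: open_gap.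
  by apply: lt_le_trans gq; rewrite divr_gt0.
move=> /qP[N /(_ N (leqnn _))[k]]; by rewrite /= g0 ltxx.
Qed.

End oscillation.

(** * Namioka properties and the game of Christensen *)

Lemma baire_N_space (R : realType) (Z : topologicalType) : baire_space Z ->
  (forall (Y : topologicalType) (f : Z * Y -> R) (e : R), cover_compact [set: Y] ->
     separately_continuous f -> 0 < e -> dense (small_osc f e)) ->
  N_space R Z.
Proof.
move=> bZ dense_osc Y cY f sf.
exists [set z | forall n : nat, small_osc f n.+1%:R^-1 z]; split; last first.
  by case: sf => fX fY x y /= xo; exact: small_osc_continuous.
move=> W W0 oW; apply: contrapT => nW.
apply: (bZ W) => //; apply/meagerP.
exists (fun n : nat => W `\` small_osc f n.+1%:R^-1); split=> [n|x Wx].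
  apply: nowhere_denseD => //; first exact: open_small_osc.
  by move=> V [oV V0] VW; apply: dense_osc.
apply: contrapT => nU; apply: nW; exists x; split=> // n.
by apply: contrapT => nx; apply: nU; exists n.
Qed.

Lemma tracking_tactic_N_space (R : realType) single (Z : topologicalType) :
  has_tracking_tactic single Z -> baire_space Z -> N_space R Z.
Proof.
move=> tZ bZ; apply: baire_N_space => // Y f e cY [fX fY] e0 V V0 oV.
by apply: (small_osc_nonmeager cY fX fY tZ) => //; exact: bZ.
Qed.

(** The interiors of the complements of the sets of points of small oscillation
cannot all be meager, since together with nowhere dense boundaries they would
exhaust [Z]. No point of such an interior has small oscillation. *)
Lemma tracking_tactic_gN_space (R : realType) single (Z : topologicalType) :
  has_tracking_tactic single Z -> nonmeager_space Z -> gN_space R Z.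
Proof.
move=> tZ nZ Y cY f [fX fY].
suff [x xo] : exists x, forall n : nat, small_osc f n.+1%:R^-1 x.
  by exists x => y; exact: small_osc_continuous.
apply: contrapT => nx; apply: nZ.
pose U (n : nat) := small_osc f n.+1%:R^-1; pose W n := interior (~` U n).
have oU n : open (U n) by exact: open_small_osc.
(* [U n `|` W n] is open and dense. *)
apply: (@meagerS _ _ (\bigcup_n (W n `|` ([set: Z] `\` (U n `|` W n))))).
  move=> x _; have /existsNP[n nxn] : ~ forall n, U n x.
    by move=> xU; apply: nx; exists x.
  exists n => //; have [Wx|nW] := pselect (W n x); [left|right] => //.
  by split=> // -[].
apply: meager_bigcup => n; apply: meagerU.
  apply: contrapT => nW.
  have [||x [Wx Ux]] := small_osc_nonmeager (e := n.+1%:R^-1) cY fX fY tZ _ _ nW.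
  - by rewrite invr_gt0.
  - exact: open_interior.
  - exact: (interior_subset Wx).
apply: nowhere_dense_meager; apply: nowhere_denseD.
- exact: openT.
- by apply: openU; [exact: oU|exact: open_interior].
move=> V [oV [x Vx]] _; have [[y [Vy Uy]]|VU] := pselect (V `&` U n !=set0).
  by exists y; split=> //; left.
exists x; split=> //; right; apply: filterS (open_nbhs_nbhs (conj oV Vx)) => y Vy Uy.
by apply: VU; exists y.
Qed.

(** Oxtoby's argument applied to a strategy of beta gives a play with nonempty
intersection, and the single marked points converge to a point of the
intersection, hence so do all their subnets. *)
Lemma tracking_tactic_tau_well (Z : topologicalType) : has_tracking_tactic true Z ->
  baire_space Z -> tau_well_beta_defavorable Z.
Proof.
move=> [M [A [pts [ok [single okex okP]]]]] bZ [s [strat win]].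
pose mv m := (A m, pts m 0%N).
pose ok' h m := ok h m /\ nonvoid_open (A m).
pose s' h := s (map mv h).
have hist h : legal A s' ok' h -> history s (map mv h).
  elim=> [|{}h m _ IH [_ oA] As]; first exact: history_nil.
  by rewrite map_rcons; exact: history_rcons.
have s0 : nonvoid_open (s [::]) by case: (strat [::] (history_nil s)).
have [h lh|h m lh|h V lh oV _||m [p mP]] := @oxtoby_play Z M A s' ok'.
- by have [] := strat _ (hist _ lh).
- have [_] := strat _ (hist _ lh).
  by rewrite /s' map_rcons /unzip1 map_rcons last_rcons.
- by have [m [okm oA AV]] := okex h V oV; exists m.
- exact: bZ.
have lm n : legal A s' ok' (mkseq m n).
  elim: n => [|n IH]; first exact: legal_nil.
  by rewrite mkseqS; have [okm Am _] := mP n; exact: legal_rcons.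
have sm n : s' (mkseq m n.+1) `<=` A (m n).
  have [_] := strat _ (hist _ (lm n.+1)).
  by rewrite /s' mkseqS map_rcons /unzip1 map_rcons last_rcons.
have [q [Aq qP]] : exists q, (forall n, A (m n) q) /\ forall U, nbhs q U ->
          exists N, forall n, (N <= n)%N -> exists k, U (pts (m n) k).
  apply: (okP m p) => n; first by have [[]] := mP n.
  by have [_ _ /sm] := mP n.+1.
apply: (win (fun n => s' (mkseq m n)) (fun n => A (m n)) (fun n => pts (m n) 0%N)).
- move=> n; split; first by have [] := strat _ (hist _ (lm n)).
  + by have [[]] := mP n.
  + by have [] := mP n.
  + exact: sm.
- by move=> n; rewrite /s' /mkseq -map_comp.
move=> D le phi [[_ _ letr ledir] cof]; exists q; first by move=> n _; exact: Aq.
move=> U /qP[N NP] d; have [d' d'P] := cof N.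
have [e [de d'e]] := ledir d d'; exists e; split=> //.
by have [k] := NP _ (d'P _ d'e); rewrite single.
Qed.

(** Beta starts in a meager open set and removes the [n]th nowhere dense set at
the [n]th move; then the open sets of the play have empty intersection. *)
Lemma tau_well_baire (Z : topologicalType) :
  tau_well_beta_defavorable Z -> baire_space Z.
Proof.
move=> tZ U oU [F [F0 UF]]; apply: tZ.
pose s (h : seq (set Z * Z)) := last U (unzip1 h) `\` closure (F (size h)).
have sL h : history s h -> nonvoid_open (last U (unzip1 h)).
  by elim=> [//|{}h A a _ _ oA _]; rewrite /unzip1 map_rcons last_rcons.
exists s; split=> [h hh|B A a play cons win].
  split; last first.
    by case: hh => // h' A a _ _ _; rewrite /s /unzip1 map_rcons !last_rcons => x [].
  have [oL L0] := sL _ hh; split.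
    by rewrite /s setDE; apply: openI => //; exact/closed_openC/closed_closure.
  have /nowhere_denseP/(_ _ (sL _ hh))[V [[oV [x Vx]] VL VF]] := F0 (size h).
  exists x; split; first exact: VL.
  exact: notin_closure_open oV VF Vx.
have sub : subnet_index (fun i j => (i <= j)%N : Prop) id.
  split; last by move=> n; exists n.
  split => //; first exact: inhabits 0%N.
    by move=> i j k; exact: leq_trans.
  by move=> i j; exists (maxn i j); rewrite leq_maxl leq_maxr.
have [p Ap _] := win _ _ _ sub.
have Bp n : B n p by have [_ _ AB _] := play n; apply: AB; exact: Ap.
have : U p by have := Bp 0%N; rewrite cons => -[].
rewrite UF => -[n _ Fp]; have := Bp n; rewrite cons => -[_]; apply.
by rewrite size_mkseq; exact: subset_closure.
Qed.

(** * Boxes in products *)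

Section boxes.
Variables (I : eqType) (T : I -> topologicalType).

Definition box (J : seq I) (V : forall i, set (T i)) : set (prod_topology T) :=
  [set w | forall j, j \in J -> V j (w j)].

Lemma open_box J V : (forall j, j \in J -> open (V j)) -> open (box J V).
Proof.
move=> oV; rewrite openE => w Vw; rewrite /interior.
apply: filter_forall_seq => j jJ.
by apply: (@proj_continuous _ T j w); apply: open_nbhs_nbhs; split; [exact: oV|exact: Vw].
Qed.

Lemma nbhs_box (w : prod_topology T) O : nbhs w O ->
  exists J V, (forall i, open (V i) /\ V i (w i)) /\ box J V `<=` O.
Proof.
pose F := [set O : set (prod_topology T) |
  exists J V, (forall i, open (V i) /\ V i (w i)) /\ box J V `<=` O].
have FF : Filter F.
  split=> [|P Q|P Q PQ].
  - by exists [::], (fun=> setT); split=> // i; split=> //; exact: openT.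
  - move=> [J [V [oV VP]]] [K [W [oW WQ]]].
    exists (J ++ K), (fun i => V i `&` W i); split=> [i|x xVW].
      by have [oVi Vi] := oV i; have [oWi Wi] := oW i; split=> //; exact: openI.
    split.
      by apply: VP => j jJ; have [|] := xVW j; rewrite ?mem_cat ?jJ.
    by apply: WQ => j jJ; have [|] := xVW j; rewrite ?mem_cat ?jJ ?orbT.
  - by move=> [J [V [oV VP]]]; exists J, V; split=> //; exact: subset_trans PQ.
suff Fw : nbhs w `<=` F by exact: Fw.
apply/cvg_sup => i A [B [[C oC <-] Cw] BA].
have CV j : open (dfwith (fun j => [set: T j]) i C j) /\ dfwith (fun j => [set: T j]) i C j (w j).
  by case: dfwithP => [|k _]; split=> //; exact: openT.
exists [:: i], (dfwith (fun j => [set: T j]) i C); split=> // x xC; apply: BA.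
by have := xC i; rewrite mem_head dfwithin; apply.
Qed.

End boxes.

(** * Trackers *)

(** A positional tactic: [C V] is the sequence of points marked when [V] is
played at stage [n], provided that [V] is small at this stage. The smallness
condition guarantees that the marks get close to every point of the sets that
have been played. *)
Definition tracker (single : bool) (T : topologicalType) (C : set T -> nat -> T)
    (small : nat -> set T -> Prop) :=
  [/\ single -> forall V k, C V k = C V 0%N,
      forall n V, nonvoid_open V ->
        exists V', [/\ nonvoid_open V', V' `<=` V & small n V']
    & forall (p : T) U, nbhs p U -> exists N, forall n V, (N <= n)%N -> small n V -> V p ->
        exists k, U (C V k)].

(** A void space has no sequence of points, but it may be a factor of a product;
hence the argument of type [T]. *)
Definition has_tracker single (T : topologicalType) :=
  T -> exists C small, @tracker single T C small.

Lemma separable_has_tracker (T : topologicalType) : separable T -> has_tracker false T.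
Proof.
move=> [D /countable_injP[f finj] dD] t.
exists (fun _ n => xget t [set x | D x /\ f x = n]), (fun _ _ => True); split=> //.
  by move=> n V oV; exists V; split.
move=> p U pU; exists 0%N => n V _ _ _.
have [x [/interior_subset Ux Dx]] : interior U `&` D !=set0.
  by apply: dD; [exists p|exact: open_interior].
exists (f x); case: xgetP => [y _ [Dy fy]|/(_ x)/not_andP[]//].
by rewrite (finj y x (mem_set Dy) (mem_set Dx) fy).
Qed.

Section small_sets.
Variables (T : topologicalType) (S : nat -> T -> T -> Prop).
Hypothesis S_nbhs : forall n (p : T), exists2 V, nbhs p V & forall x y, V x -> V y -> S n x y.
Hypothesis S_small : forall (p : T) U, nbhs p U -> exists N, forall n q, (N <= n)%N ->
  S n p q -> U q.

(** [S n x y] stands for closeness up to [1 / (n + 1)], be it expressed by the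
balls of a pseudometric type or by a distance function. *)
Lemma small_sets_has_tracker single : has_tracker single T.
Proof.
move=> t.
exists (fun V _ => xget t V), (fun n V => forall x y, V x -> V y -> S n x y); split=> //.
  move=> n V [oV [p Vp]]; have [W pW WS] := S_nbhs n p.
  exists (V `&` interior W); split.
  - split; last by exists p.
    by apply: openI => //; exact: open_interior.
  - by move=> ? [].
  - by move=> x y [_ /interior_subset Wx] [_ /interior_subset Wy]; exact: WS.
move=> p U /S_small[N NP]; exists N => n V Nn VS Vp; exists 0%N.
by apply: (NP n) => //; apply: VS => //; case: xgetP => // /(_ p).
Qed.

End small_sets.

Lemma pseudometric_has_tracker (R : realType) (T : pseudoMetricType R) single :
  has_tracker single T.
Proof.
apply: (@small_sets_has_tracker T (fun n x y => ball x (n.+1%:R^-1 : R) y)) => [n p|p U].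
  exists (ball p (n.+1%:R^-1 / 2)); first by apply: nbhsx_ballx; rewrite divr_gt0.
  by move=> x y px py; apply: ball_splitr px py.
rewrite -nbhs_ballE => -[e e0 eU].
have [N NP] := eventually_invn_lt e0; exists N => n q /NP ne pq; apply: eU.
exact: le_ball (ltW ne) _ pq.
Qed.

Lemma pseudo_metrizable_has_tracker (R : realType) (T : topologicalType) single :
  pseudo_metrizable R T -> has_tracker single T.
Proof.
move=> [d [d0 dxx dC dT nb]].
apply: (@small_sets_has_tracker T (fun n x y => d x y < n.+1%:R^-1)) => [n p|p U].
  exists [set y | d p y < n.+1%:R^-1 / 2].
    by rewrite nb; exists (n.+1%:R^-1 / 2) => //=; rewrite divr_gt0.
  move=> x y /= px py; rewrite (splitr n.+1%:R^-1).
  by apply: le_lt_trans (dT x p y) _; rewrite ltrD // dC.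
rewrite nb => -[e /= e0 eU].
have [N NP] := eventually_invn_lt e0; exists N => n q /NP ne pq; apply: eU => /=.
exact: lt_trans ne.
Qed.

Lemma has_tracker_prod (T1 T2 : topologicalType) :
  has_tracker false T1 -> has_tracker false T2 -> has_tracker false (T1 * T2)%type.
Proof.
move=> t1 t2 [p1 p2].
have [C1 [s1 [_ sh1 tr1]]] := t1 p1; have [C2 [s2 [_ sh2 tr2]]] := t2 p2.
pose code (k : nat) : nat * nat := odflt (0%N, 0%N) (choice.unpickle k).
exists (fun V k => (C1 (fst @` V) (code k).1, C2 (snd @` V) (code k).2)).
exists (fun n V => s1 n (fst @` V) /\ s2 n (snd @` V)); split=> //.
  move=> n V [oV [[x1 x2] Vx]].
  have [[U1 U2] [/= U1x U2x] UV] := open_nbhs_nbhs (conj oV Vx).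
  have [|V1 [[oV1 [y1 V1y]] VU1 sV1]] := sh1 n (interior U1).
    by split; [exact: open_interior|exists x1].
  have [|V2 [[oV2 [y2 V2y]] VU2 sV2]] := sh2 n (interior U2).
    by split; [exact: open_interior|exists x2].
  exists (V1 `*` V2); split.
  - split; last by exists (y1, y2).
    rewrite openE => -[z1 z2] [/= V1z V2z]; exists (V1, V2) => //.
    by split; exact: open_nbhs_nbhs.
  - move=> [z1 z2] [/= /VU1/interior_subset Uz1 /VU2/interior_subset Uz2].
    exact: UV.
  - have -> : fst @` (V1 `*` V2) = V1.
      apply/seteqP; split=> [_ [[z1 z2] [/= Vz _] <-]//|z1 Vz].
      by exists (z1, y2).
    suff -> : snd @` (V1 `*` V2) = V2 by [].
    apply/seteqP; split=> [_ [[z1 z2] [/= _ Vz] <-]//|z2 Vz].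
    by exists (y1, z2).
move=> [q1 q2] U [[U1 U2] [/= /tr1[N1 NP1] /tr2[N2 NP2]] UU].
exists (maxn N1 N2) => n V; rewrite geq_max => /andP[n1 n2] [sV1 sV2] Vq.
have [|k1 k1P] := NP1 _ _ n1 sV1; first by exists (q1, q2).
have [|k2 k2P] := NP2 _ _ n2 sV2; first by exists (q1, q2).
by exists (choice.pickle (k1, k2)); rewrite /code choice.pickleK; exact: UU.
Qed.

Section product.
Variables (I : eqType) (T : I -> topologicalType) (Z : topologicalType).
Variable e : Z -> prod_topology T.

(** Stated in terms of boxes: the sets [e @^-1` box J V] form a base, restricted
to the boxes that lie in the image of [e]. *)
Definition open_embedding :=
  (forall i, continuous (fun z => e z i)) /\
  forall z U, nbhs z U -> exists J V, [/\ forall i, open (V i) /\ V i (e z i),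
    forall z', box J V (e z') -> U z' & forall w, box J V w -> exists z', e z' = w].

(** A move is a box whose support contains the supports of the previous boxes
and whose sides are small for the trackers of the factors. The marked points
have, on the support, coordinates marked by the trackers, and elsewhere the
coordinates of a base point. The limit point is obtained from a point of the
intersection by moving the coordinates outside all supports to the base point;
this does not leave the boxes. *)
Lemma product_tracking_tactic single : (forall i, has_tracker single (T i)) ->
  open_embedding -> has_tracking_tactic single Z.
Proof.
move=> tT [ec eO]; have [[z0]|nZ] := pselect (inhabited Z); last first.
  exists void, (fun=> set0), (@of_void (nat -> Z)), (fun _ _ => True).
  split=> [_ []|h V [_ [x _]]|m]; last by case: (m 0%N).
  by exfalso; apply: nZ; exists.
have tr i := cid (tT i (e z0 i)).
pose C i := projT1 (tr i); pose small i := projT1 (cid (projT2 (tr i))).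
have CP i : tracker single (C i) (small i) := projT2 (cid (projT2 (tr i))).
pose M := (seq I * (forall i, set (T i)))%type.
pose A (m : M) := e @^-1` box m.1 m.2.
(* The mark of index [k] is given by a finite list of indices of marks in the
   factors, one for each coordinate of the support. *)
pose code (k : nat) : seq nat := odflt [::] (choice.unpickle k).
pose q (m : M) k : prod_topology T := fun i => if i \in m.1
  then C i (m.2 i) (nth 0%N (code k) (index i m.1)) else e z0 i.
pose pts m k := xget z0 [set z | e z = q m k].
pose ok (h : seq M) (m : M) := [/\ {subset last [::] (map fst h) <= m.1},
  forall j, j \in m.1 -> small j (size h) (m.2 j)
  & forall w, box m.1 m.2 w -> exists z, e z = w].
exists M, A, pts, ok; split=> [single1 m k|h V [oV [z Vz]]|m p mok Ap].
- rewrite /pts; suff -> : q m k = q m 0%N by [].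
  apply: functional_extensionality_dep => i; rewrite /q; case: ifP => // _.
  by have [/(_ single1) CE _ _] := CP i; rewrite CE [RHS]CE.
- have [J [W [oW WV We]]] := eO z V (open_nbhs_nbhs (conj oV Vz)).
  have shrink i : exists V', [/\ nonvoid_open V', V' `<=` W i & small i (size h) V'].
    by have [_ sh _] := CP i; apply: sh; have [? ?] := oW i; split=> //; exists (e z i).
  pose V' i := projT1 (cid (shrink i)).
  have V'P i : [/\ nonvoid_open (V' i), V' i `<=` W i & small i (size h) (V' i)].
    exact: projT2 (cid (shrink i)).
  pose m : M := (J ++ last [::] (map fst h), V').
  have boxW w : box m.1 m.2 w -> box J W w.
    by move=> mw j jJ; have [_ + _] := V'P j; apply; apply: mw; rewrite mem_cat jJ.
  exists m; split.
  + split; first by move=> j jh; rewrite mem_cat jh orbT.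
      by move=> j _; case: (V'P j).
    by move=> w /boxW; exact: We.
  + split.
      rewrite openE => y Ay; rewrite /interior.
      have : nbhs y [set y | forall j, j \in m.1 -> V' j (e y j)].
        apply: filter_forall_seq => j jm; apply: (ec j y).
        apply: open_nbhs_nbhs; split; last exact: Ay.
        by have [[]] := V'P j.
      by [].
    have V'0 i : exists x, V' i x by have [[]] := V'P i.
    pose w : prod_topology T := fun i => projT1 (cid (V'0 i)).
    have mw : box m.1 m.2 w by move=> i _; exact: projT2 (cid (V'0 i)).
    by have [z' z'w] := We _ (boxW _ mw); exists z'; rewrite /A /= z'w.
  + by move=> z' /boxW; exact: WV.
have okS n : {subset (m n).1 <= (m n.+1).1}.
  by have [+ _ _] := mok n.+1; rewrite mkseqS map_rcons last_rcons.
have ok_le i n n' : (n <= n')%N -> i \in (m n).1 -> i \in (m n').1.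
  by move=> /subnK <-; elim: (n' - n)%N => [//|k IH] /IH; exact: okS.
pose w : prod_topology T := fun i =>
  if pselect (exists n, i \in (m n).1) is left _ then e p i else e z0 i.
have w_in n i : i \in (m n).1 -> w i = e p i.
  by move=> im; rewrite /w; case: pselect => // nex; exfalso; apply: nex; exists n.
have w_out i : (forall n, i \notin (m n).1) -> w i = e z0 i.
  by move=> im; rewrite /w; case: pselect => // -[n]; rewrite (negPf (im n)).
have wbox n : box (m n).1 (m n).2 w.
  by move=> j jm; rewrite (w_in _ _ jm); exact: Ap.
have [y ey] : exists z, e z = w by have [_ _] := mok 0%N; apply; exact: wbox.
exists y; split; first by move=> n; rewrite /A /= ey.
move=> U yU; have [J [V [oV VU Ve]]] := eO y U yU.
have [N _ NP] : \forall n \near \oo, forall j, j \in J ->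
    (j \in (m n).1 -> exists k, V j (C j ((m n).2 j) k)) /\
    (j \notin (m n).1 -> V j (e z0 j)).
  apply: filter_forall_seq => j _; have [oVj Vj] := oV j; rewrite ey in Vj.
  have [[n0 jn0]|nj] := pselect (exists n, j \in (m n).1).
    have [_ _ trj] := CP j.
    have [N NP] := trj _ _ (open_nbhs_nbhs (conj oVj Vj)).
    exists (maxn n0 N) => // n /=; rewrite geq_max => /andP[n0n Nn].
    have jn := ok_le _ _ _ n0n jn0; rewrite jn; split=> // _.
    apply: (NP n) => //; last exact: wbox.
    by have [_ + _] := mok n; rewrite size_mkseq; apply.
  exists 0%N => // n _; split; first by move=> jn; exfalso; apply: nj; exists n.
  move=> _; rewrite -w_out // => n'; apply/negP => jn; apply: nj; by exists n'.
exists N => n /NP {}NP.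
have /choice[k kP] : forall j, exists k, j \in J -> j \in (m n).1 ->
    V j (C j ((m n).2 j) k).
  move=> j; have [jJ|jJ] := boolP (j \in J); last by exists 0%N.
  have [jm|jm] := boolP (j \in (m n).1); last by exists 0%N.
  by have [/(_ jm)[k kP] _] := NP j jJ; exists k.
exists (choice.pickle (map k (m n).1)).
have qV : box J V (q (m n) (choice.pickle (map k (m n).1))).
  move=> j jJ; rewrite /q /code choice.pickleK /=; case: ifP => jm.
    by rewrite (nth_map j) ?index_mem // nth_index //; exact: kP.
  by have [_] := NP j jJ; apply; rewrite jm.
apply: VU; rewrite /pts; case: xgetP => [z _ ->//|nz].
by have [z' z'q] := Ve _ qV; have := nz z'.
Qed.

End product.

Section embeddings.
Variables (I : eqType) (T : I -> topologicalType).

Lemma open_embedding_id : open_embedding (id : prod_topology T -> prod_topology T).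
Proof.
split=> [i|w O /nbhs_box[J [V [oV VO]]]]; first exact: proj_continuous.
by exists J, V; split=> // w'; exists w'.
Qed.

Lemma open_embedding_set_val (X : set (prod_topology T)) : open X ->
  open_embedding (set_val : set_type X -> prod_topology T).
Proof.
move=> oX; split=> [i z|z U [B [[G oG <-] Gz] GU]].
  apply: (@continuous_comp _ _ _ (set_val : set_type X -> prod_topology T) (@proj _ T i)).
    exact: initial_continuous.
  exact: proj_continuous.
have [J [V [oV VO]]] : exists J V, (forall i, open (V i) /\ V i (set_val z i)) /\
    box J V `<=` G `&` X.
  apply: nbhs_box; apply: open_nbhs_nbhs; split; first exact: openI.
  by split=> //; exact: set_valP.
exists J, V; split=> // [z' /VO[Gz' _]|w /VO[_ Xw]]; first exact: GU.
by exists (SigSub (mem_set Xw)).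
Qed.

End embeddings.

(** A space is a product with one factor. *)
Lemma tracker_tracking_tactic single (Z : topologicalType) :
  has_tracker single Z -> has_tracking_tactic single Z.
Proof.
move=> tZ; apply: (@product_tracking_tactic unit (fun=> Z) Z (fun z _ => z)) => //.
split=> [_ z A //|z U zU].
exists [:: tt], (fun=> interior U); split=> [_|z' /(_ tt)|w _].
- by split; [exact: open_interior|].
- by rewrite mem_head => /(_ isT) /interior_subset.
- by exists (w tt); apply: functional_extensionality_dep => -[].
Qed.

(** * Discontinuity on meager sets of completely regular spaces *)

(** The one-point compactification of the discrete space [G], with [None] as the
point at infinity. *)
Definition opc (G : Type) := option G.

Section opc_topology.
Variable G : choiceType.

HB.instance Definition _ := Choice.on (opc G).

Let op : set_system (opc G) := [set U | U None -> finite_set (~` U)].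

Let opT : op setT.
Proof. by move=> _; rewrite setCT. Qed.

Let opI : setI_closed op.
Proof. by move=> A B oA oB [/oA fA /oB fB]; rewrite setCI finite_setU. Qed.

Let op_bigU (I : Type) (f : I -> set (opc G)) :
  (forall i, op (f i)) -> op (\bigcup_i f i).
Proof.
move=> of_ [i _ /of_ fi]; apply: sub_finite_set fi.
by apply: subsetC => y fy; exists i.
Qed.

HB.instance Definition _ := isOpenTopological.Build (opc G) opT opI op_bigU.

Lemma open_opc (U : set (opc G)) : open U <-> (U None -> finite_set (~` U)).
Proof. by []. Qed.

Lemma cover_compact_opc : cover_compact [set: opc G].
Proof.
move=> I D h oh cD.
have [i0 Di0 hi0] := cD None Logic.I.
have /choice[k kP] : forall y, exists i, D i /\ h i y.
  by move=> y; have [i Di hi] := cD y Logic.I; exists i.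
have /finite_fsetP[A AE] := (open_opc _).1 (oh _ Di0) hi0.
exists (i0 |` (k @` A))%fset.
  move=> i; rewrite !inE => /orP[/eqP->|/imfsetP[y _ ->]]; first exact/mem_set.
  by apply/mem_set; case: (kP y).
move=> y _; have [hy|nhy] := pselect (h i0 y).
  by exists i0 => //=; rewrite !inE eqxx.
exists (k y); last by case: (kP y).
rewrite /= !inE; apply/orP; right; apply/imfsetP; exists y => //=.
by have : (~` h i0) y by []; rewrite AE.
Qed.

Lemma continuous_opc (R : realType) (u : opc G -> R) : u None = 0 ->
  (forall e, 0 < e -> finite_set [set g | e <= `|u (Some g)|]) -> continuous u.
Proof.
move=> u0 fu; apply/continuousP => A oA; apply/open_opc => /= A0.
have /nbhs_ballP[e /= e0 eA] := open_nbhs_nbhs (conj oA A0).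
apply: sub_finite_set (finite_image Some (fu e e0)) => -[g|] //= nA.
exists g => //=; rewrite leNgt; apply/negP => ue; apply: nA; apply: eA.
by rewrite /ball /= u0 sub0r normrN.
Qed.

End opc_topology.

Section spikes.
Variable R : realType.

(** Twice the positive part of [m t (3 - m t)]. As [m] varies, each [t > 0] has
only finitely many nonzero values [hat m t], yet one of them is at least [1]
however small [t] is, provided that [t <= 1]. *)
Definition hat (m : nat) (t : R) : R :=
  m%:R * t * (3 - m%:R * t) + `|m%:R * t * (3 - m%:R * t)|.

Lemma hat0 m : hat m 0 = 0.
Proof. by rewrite /hat mulr0 mul0r normr0 addr0. Qed.

Lemma hat_bound m t : `|hat m t| <= 5.
Proof.
rewrite /hat; set a := m%:R * t.
have : a * (3 - a) <= 9 / 4 by have := sqr_ge0 (a - 3 / 2); rewrite expr2; lra.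
by case: (ger0P (a * (3 - a))) => h; rewrite ler_norml; lra.
Qed.

Lemma hat_neq0 m t : 0 < t -> hat m t != 0 -> m%:R < 3 / t.
Proof.
move=> t0; rewrite ltr_pdivlMr //; set a := m%:R * t; rewrite /hat -/a.
have a0 : 0 <= a by rewrite mulr_ge0 ?ler0n // ltW.
rewrite ltNge; apply: contra => a3.
by rewrite ler0_norm ?subrr // mulr_ge0_le0 // subr_le0.
Qed.

Lemma hat_large t : 0 < t -> t <= 1 -> exists m, 1 <= hat m t.
Proof.
move=> t0 t1.
(* The least [m] with [1 <= m t] also satisfies [m t <= 2]. *)
have ex : exists m : nat, 1 <= m%:R * t.
  exists (Num.bound t^-1); rewrite -ler_pdivrMr // mul1r; apply/ltW.
  by have := archi_boundP (ltW (divr_gt0 ltr01 t0 : 0 < 1 / t)); rewrite div1r.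
case: (ex_minnP ex) => m m1 mmin; exists m.
have m2 : m%:R * t <= 2.
  case: m m1 mmin => [|m] m1 mmin; first by move: m1; rewrite mul0r; lra.
  have : m%:R * t < 1.
    by rewrite ltNge; apply/negP => /mmin; rewrite ltnn.
  by rewrite -natr1 mulrDl mul1r; lra.
rewrite /hat; set a := m%:R * t in m1 m2 *.
have : 1 <= a * (3 - a) by nra.
by have := normr_ge0 (a * (3 - a)); lra.
Qed.

Lemma continuous_hat m : continuous (hat m).
Proof.
have c : continuous (fun t : R => m%:R * t * (3 - m%:R * t)).
  move=> t; have ct : (fun t : R => m%:R * t) @ t --> m%:R * t.
    by apply: cvgM; [exact: cvg_cst|exact: cvg_id].
  by apply: cvgM => //; apply: cvgB => //; exact: cvg_cst.
by move=> t; apply: cvgD; [exact: c|apply: cvg_norm; exact: c].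
Qed.

End spikes.

Section nowhere_continuous.
Variables (R : realType) (X : topologicalType).
Hypothesis crX : completely_regular R X.
Variable F : nat -> set X.
Hypothesis F0 : forall n, nowhere_dense (F n).

Let coz (g : X -> R) := [set x | g x != 0].

Let bumps n := [set g : X -> R |
  [/\ continuous g, range g `<=` `[0, 1] & forall x, F n x -> g x = 0]].

(** For each [n], the supports of the members of [E n] are disjoint and their
   union is dense. *)
Let E n : set (X -> R) := projT1 (ex_maximal_disjoint_subcollection coz (bumps n)).

Let EP n : maximal_disjoint_subcollection coz (E n) (bumps n).
Proof. by rewrite /E; case: (ex_maximal_disjoint_subcollection _ _). Qed.

Let E_dense n U : nonvoid_open U -> exists2 g, E n g & U `&` coz g !=set0.
Proof.
move=> oU; have /nowhere_denseP/(_ _ oU)[V [[oV [x Vx]] VU VF]] := F0 n.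
have [f [cf f01 fx fV]] := crX (open_nbhs_nbhs (conj oV Vx)).
pose g y := 1 - f y.
have gV y : coz g y -> V y.
  move=> gy; apply: contrapT => /fV fy; move: gy.
  by rewrite /coz /= /g fy subrr eqxx.
have gx : coz g x by rewrite /coz /= /g fx subr0 oner_eq0.
have bg : bumps n g.
  split.
  - by move=> y; apply: cvgB; [exact: cvg_cst|exact: cf].
  - move=> _ [y _ <-]; have := f01 (f y); rewrite /= !in_itv /= /g => /(_ _)/andP[].
      by exists y.
    by move=> ? ?; apply/andP; split; lra.
  - move=> y Fy; apply/eqP; apply: contraPT Fy => /gV; exact: VF.
have [|h Eh [y [hy gy]]] := maximal_disjoint_meets (EP n) bg; first by exists x.
by exists h => //; exists y; split=> //; exact/VU/gV.
Qed.

(** The index of a bump: the number of the nowhere dense set, the function, and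
   the height at which [hat] selects its values. The factor [n.+1%:R^-1] makes
   the contributions of large [n] small, as continuity at infinity requires. *)
Let G : choiceType := {classic (nat * (X -> R) * nat)}.

Let u (z : X * opc G) : R := if z.2 is Some (n, g, m) then
  if pselect (E n g) is left _ then n.+1%:R^-1 * hat m (g z.1) else 0 else 0.

Let u_sep : separately_continuous u.
Proof.
split=> [[[[n g] m]|] x|x].
- rewrite /u /=; case: pselect => Eg; last exact: cvg_cst.
  apply: cvgM; first exact: cvg_cst.
  have [/(_ _ Eg)[cg _ _] _ _] := EP n.
  exact: (@continuous_comp _ _ _ g (@hat R m) x (cg x) (@continuous_hat R m (g x))).
- exact: cvg_cst.
apply: continuous_opc => // e e0.
have [N NP] := eventually_invn_lt (divr_gt0 e0 (ltr0Sn R 4)).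
have /choice[g gP] : forall n, exists g, forall h, E n h -> coz h x -> h = g.
  move=> n; have [[g [Eg gx]]|nE] := pselect (exists g, E n g /\ coz g x).
    exists g => h Eh hx; have [_ tE _] := EP n.
    by apply: tE => //; exists x.
  by exists (fun=> 0) => h Eh hx; exfalso; apply: nE; exists h.
pose M n := Num.bound (3 / g n x).
have fin : finite_set (\bigcup_(n in `I_N) ((fun m => (n, g n, m)) @` `I_(M n))).
  apply: bigcup_finite; first exact: finite_II.
  by move=> n _; apply: finite_image; exact: finite_II.
apply: sub_finite_set fin => -[[n h] m]; rewrite /u /=.
case: pselect => [Eh ue|_]; last by rewrite normr0 => e0'; move: e0; rewrite ltNge e0'.
have nN : (n < N)%N.
  rewrite ltnNge; apply/negP => /NP; apply/negP; rewrite -leNgt.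
  rewrite normrM ger0_norm ?invr_ge0 ?ler0n // in ue.
  rewrite ler_pdivrMr; last by lra.
  apply: le_trans ue _; rewrite ler_pM2l ?invr_gt0 //.
  by apply: le_trans (hat_bound m (h x)) _; lra.
have hm : hat m (h x) != 0.
  by apply/eqP => h0; move: ue; rewrite h0 mulr0 normr0 leNgt e0.
have hx : coz h x by apply: contraNneq hm => ->; rewrite hat0.
have hg := gP n h Eh hx; exists n => //; exists m; last by rewrite hg.
rewrite /M -hg /=; have [/(_ _ Eh)[_ h01 _] _ _] := EP n.
have h0 : 0 < h x.
  rewrite lt_neqAle eq_sym hx /=; have : `[0, 1]%classic (h x) by apply: h01; exists x.
  by rewrite /= in_itv /= => /andP[].
rewrite -(ltr_nat R); apply: lt_trans (hat_neq0 h0 hm) _.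
by apply: archi_boundP; rewrite divr_ge0 // ltW.
Qed.

(** Near [(x, None)] the values of [u] at indices [n] would be small at all but
finitely many indices. At these [u] vanishes on [F n] and is continuous in its
first variable, so that all values at indices [n] would be small near [x]. But
[hat] takes large values of members of [E n] arbitrarily near [x]. *)
Let u_discontinuous x : (\bigcup_n F n) x -> ~ {for (x, None), continuous u}.
Proof.
move=> [n _ Fx] /cvgrPdist_lt/(_ (n.+1%:R^-1)).
rewrite invr_gt0 ltr0Sn => /(_ isT)[[V W] /= [xV W0] VW].
have /finite_fsetP[A AE] := (open_opc _).1 (open_interior W) W0.
pose V' := \bigcap_(y in [set` A])
  [set x' | forall g m, y = Some (n, g, m) -> `|u (x', y)| < n.+1%:R^-1].
have xV' : nbhs x (V `&` V').
  apply: filterI => //; apply: filter_bigI => y _.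
  have [[g [m yE]]|ny] := pselect (exists g m, y = Some (n, g, m)); last first.
    by apply: nearW => x' g m yE; exfalso; apply: ny; exists g, m.
  have ux : u (x, y) = 0.
    rewrite yE /u /=; case: pselect => // Eg.
    by have [/(_ _ Eg)[_ _ /(_ _ Fx) ->] _ _] := EP n; rewrite hat0 mulr0.
  have /cvgrPdist_lt/(_ (n.+1%:R^-1)) := u_sep.1 y x.
  rewrite invr_gt0 ltr0Sn => /(_ isT); apply: filterS => x'.
  by rewrite ux sub0r normrN => ux' ? ? _.
have [|g Eg [x' [/interior_subset[Vx' V'x'] gx']]] := @E_dense n (interior (V `&` V')).
  by split; [exact: open_interior|exists x].
have [/(_ _ Eg)[_ g01 _] _ _] := EP n.
have : `[0, 1]%classic (g x') by apply: g01; exists x'.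
rewrite /= in_itv /= => /andP[g0 g1].
have g0' : 0 < g x' by rewrite lt_neqAle eq_sym gx'.
have [m hm] := hat_large g0' g1.
pose y : opc G := Some (n, g, m).
have uy : n.+1%:R^-1 <= `|u (x', y)|.
  rewrite /u /=; case: pselect => // _; rewrite normrM ger0_norm ?invr_ge0 //.
  by rewrite ler_peMr ?invr_ge0 // (le_trans hm) // ler_norm.
have [Wy|nWy] := pselect (interior W y).
  have := VW (x', y) (conj Vx' (interior_subset Wy)).
  by rewrite /= {1}/u /= sub0r normrN ltNge uy.
have yA : [set` A] y by rewrite -AE.
by have := V'x' y yA g m erefl; rewrite ltNge uy.
Qed.

Lemma nowhere_continuous_on : exists (Y : topologicalType) (f : X * Y -> R) (y : Y),
  [/\ cover_compact [set: Y], separately_continuous f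
    & forall x, (\bigcup_n F n) x -> ~ {for (x, y), continuous f}].
Proof.
exists (opc G), u, None; split; [exact: cover_compact_opc|exact: u_sep|].
exact: u_discontinuous.
Qed.

End nowhere_continuous.

Lemma completely_regular_N_baire (R : realType) (X : topologicalType) :
  completely_regular R X -> N_space R X -> baire_space X.
Proof.
move=> crX NX U [oU U0] [F [F0 UF]].
have [Y [f [y [cY sf nf]]]] := nowhere_continuous_on crX F0.
have [D [dD Df]] := NX Y cY f sf.
have [x [Ux Dx]] := dD U U0 oU.
by apply: (nf x); [rewrite -UF|exact: Df].
Qed.

Lemma completely_regular_gN_nonmeager (R : realType) (X : topologicalType) :
  completely_regular R X -> gN_space R X -> nonmeager_space X.
Proof.
move=> crX gX [F [F0 UF]].
have [Y [f [y [cY sf nf]]]] := nowhere_continuous_on crX F0.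
have [x xf] := gX Y cY f sf.
by apply: (nf x); [rewrite -UF|exact: xf].
Qed.

(** Uniform spaces are completely regular, and the product of the uniformities
induces the product topology. *)
Lemma completely_regular_subspace (R : realType) (I : Type) (T : I -> pseudoMetricType R)
     (X : set (prod_topology (fun i => T i : topologicalType))) :
  completely_regular R (set_type X).
Proof.
move=> x U Ux.
have : @uniform_separator (set_type X) [set x] (~` interior U).
  apply: (@point_uniform_separator R
    (set_type (X : set (prod_topology (fun i => T i : uniformType)))) x (~` interior U)).
    exact/open_closedC/open_interior.
  by apply.
move=> /(@uniform_separatorP _ R)[f [cf f01 f0 f1]]; exists f; split=> //.
  by apply: f0; exists x.
move=> y nUy; apply: f1; exists y => //= Uy; apply: nUy; exact: interior_subset.
Qed.

(** * Rich families *)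

Section rich.
Variable X : topologicalType.

Lemma closure_S_cl (C : set X) : countable C -> C !=set0 -> S_cl (closure C).
Proof.
move=> cC [c Cc]; split; [by exists c; exact: subset_closure|exact: closed_closure|].
exists [set z : set_type (closure C) | C (set_val z)].
  have /countable_injP[f finj] := cC.
  apply/countable_injP; exists (fun z => f (set_val z)).
  move=> z1 z2 /set_mem C1 /set_mem C2 f12; apply: val_inj.
  by apply: finj => //; exact: mem_set.
move=> V [z Vz] [G oG GV]; rewrite -GV in Vz *.
have [c' [Cc' Gc']] := set_valP z _ (open_nbhs_nbhs (conj oG Vz)).
by exists (SigSub (mem_set (subset_closure Cc'))).
Qed.

Lemma separable_dense_in (A : set X) : separable (set_type A) ->
  exists D, [/\ countable D, D `<=` A & A `<=` closure D].
Proof.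
move=> [D cD dD]; exists (set_val @` D); split.
- exact: card_le_trans (card_image_le _ _) cD.
- by move=> _ [z _ <-]; exact: set_valP.
- move=> x Ax U /nbhs_interior xU.
  have [||z [Uz Dz]] := dD (set_val @^-1` interior U).
  + by exists (SigSub (mem_set Ax)); exact: nbhs_singleton.
  + by exists (interior U) => //; exact: open_interior.
  + by exists (set_val z); split; [exists z|exact: interior_subset].
Qed.

(** A member of the family that catches countably many local conditions: by
tightness the condition [closure (S n x) x] is witnessed by countably many
points, and closing off a separable member under the witnesses of a dense
sequence of its points, in countably many steps, gives [A]. *)
Lemma rich_trace (F : set (set X)) (S : nat -> X -> set X) (U : set X) :
  countably_tight X -> rich_family F -> (forall n x, closure (S n x) x) ->
  U !=set0 ->
  exists A D, [/\ F A, A `&` U !=set0, D `<=` A, A `<=` closure D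
    & forall n x, D x -> closure (A `&` S n x) x].
Proof.
move=> tX [FS Fcof Fchain] Scl [u Uu].
have /choice[C CP] : forall nx : nat * X, exists C : set X,
    [/\ countable C, C `<=` S nx.1 nx.2 & closure C nx.2].
  by move=> [n x]; exact: tX.
pose Q := {AD : set X * set X |
  [/\ F AD.1, countable AD.2, AD.2 `<=` AD.1 & AD.1 `<=` closure AD.2]}.
have FD A : F A -> exists D, [/\ F A, countable D, D `<=` A & A `<=` closure D].
  by move=> FA; have [_ _ /separable_dense_in[D [cD DA AD]]] := FS _ FA; exists D.
have next (p : Q) : {p' : Q | (sval p).1 `<=` (sval p').1 /\
    forall n x, (sval p).2 x -> C (n, x) `<=` (sval p').1}.
  apply: cid; case: p => -[A D] /= [FA cD DA AD].
  (* The index [0] adds the points of [D] themselves. *)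
  pose B := \bigcup_(x in D) \bigcup_k (if k is n.+1 then C (n, x) else [set x]).
  have cB : countable B.
    apply: bigcup_countable => // x _; apply: bigcup_countable => // -[|n] _.
      exact: countable1.
    by case: (CP (n, x)).
  have DB : D `<=` B by move=> d Dd; exists d => //; exists 0%N.
  have B0 : B !=set0.
    have [[a Aa] _ _] := FS _ FA; have [d [Dd _]] := AD a Aa setT filterT.
    by exists d; exact: DB.
  have [A' FA' BA'] := Fcof _ (closure_S_cl cB B0).
  have [D' AD'] := FD _ FA'; exists (exist _ (A', D') AD') => /=; split.
    apply: subset_trans BA'; apply: subset_trans AD _.
    exact: closure_subset.
  move=> n x Dx; apply: subset_trans BA'.
  apply: subset_trans (@subset_closure _ _) => c Cc.
  by exists x => //; exists n.+1.
have [A0 FA0 uA0] : exists2 A, F A & closure [set u] `<=` A.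
  by apply/Fcof/closure_S_cl; [exact: countable1|exists u].
have [D0 AD0] := FD _ FA0.
have [p [p0 pS]] := dependent_choice next (exist _ (A0, D0) AD0).
pose A k := (sval (p k)).1; pose D k := (sval (p k)).2.
have pP k : [/\ F (A k), countable (D k), D k `<=` A k & A k `<=` closure (D k)].
  by rewrite /A /D; case: (p k).
exists (closure (\bigcup_k A k)), (\bigcup_k D k); split.
- by apply: Fchain => k; [case: (pP k)|case: (pS k)].
- exists u; split=> //; apply: subset_closure; exists 0%N => //.
  by rewrite /A p0; apply: uA0; exact: subset_closure.
- move=> x [k _ Dx]; apply: subset_closure; exists k => //.
  by have [_ _ DA _] := pP k; exact: DA.
- rewrite ((closure_id _).1 (@closed_closure _ (\bigcup_k D k))).
  apply: closure_subset => x [k _ Ax]; have [_ _ _ AD] := pP k.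
  have := AD _ Ax; apply: closure_subset => y Dy; by exists k.
- move=> n x [k _ Dx]; have [_ CS Cx] := CP (n, x).
  apply: closure_subset Cx => c Cc; split; last exact: CS.
  apply: subset_closure; exists k.+1 => //.
  by have [_ +] := pS k; apply; eassumption.
Qed.

End rich.

(** Trace the complements of the nowhere dense sets: these sets remain nowhere
dense in the member of the family. *)
Lemma rich_baire (X : topologicalType) (F : set (set X)) : countably_tight X ->
  rich_family F -> (forall A, F A -> baire_space (set_type A)) -> baire_space X.
Proof.
move=> tX rF bF U [oU U0] [N [N0 UN]].
have [|A [D [FA [u [Au Uu]] DA AD clD]]] :=
    @rich_trace X F (fun n _ => ~` closure (N n)) U tX rF _ U0.
  move=> n x V xV.
  have /nowhere_denseP/(_ (interior V))[|W [[oW [y Wy]] WV WN]] := N0 n.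
    by split; [exact: open_interior|exists x].
  exists y; split; last exact: (interior_subset (WV _ Wy)).
  exact: notin_closure_open oW WN Wy.
apply: (bF A FA (set_val @^-1` U)).
  by split; [exists U|exists (SigSub (mem_set Au))].
apply/meagerP; exists (fun n => set_val @^-1` N n); split; last first.
  by move=> z; rewrite /= UN => -[n _ Nz]; exists n.
move=> n; apply/nowhere_denseP => V [oV [z Vz]].
have [G oG GV] := oV; rewrite -GV /= in Vz *.
have [d [Dd Gd]] := AD _ (set_valP z) _ (open_nbhs_nbhs (conj oG Vz)).
have [x [[Ax nx] Gx]] := clD n d Dd _ (open_nbhs_nbhs (conj oG Gd)).
exists (set_val @^-1` (G `&` ~` closure (N n))); split.
- split; last by exists (SigSub (mem_set Ax)).
  exists (G `&` ~` closure (N n)) => //; apply: openI => //.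
  exact/closed_openC/closed_closure.
- by move=> y [].
- by move=> y [_ ny] Ny; apply: ny; exact: subset_closure.
Qed.

(** If the oscillation exceeds [e] throughout [W], then each [x] in [W] is in
the closure of the points [x'] for which [f (x', _)] differs from [f (x, _)] by
more than [e / 2]. Tracing this condition contradicts the Namioka property of
the separable Baire member of the family. *)
Lemma rich_N_space (R : realType) (X : topologicalType) (F : set (set X)) :
  countably_tight X -> rich_family F ->
  (forall A, F A -> baire_space (set_type A)) -> N_space R X.
Proof.
move=> tX rF bF; apply: baire_N_space; first exact: rich_baire tX rF bF.
move=> Y f e cY [fX fY] e0 W W0 oW; apply: contrapT => nW.
pose S (n : nat) x := if pselect (W x) is left _
  then [set x' | exists y, e / 2 < `|f (x, y) - f (x', y)|] else setT.
have e20 : 0 < e / 2 by rewrite divr_gt0.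
have [|A [D [FA [w [Aw Ww]] DA AD clD]]] := @rich_trace X F S W tX rF _ W0.
  move=> k x; rewrite /S; case: pselect => [Wx|_]; last first.
    by move=> V xV; exists x; split=> //; exact: nbhs_singleton.
  move=> V xV; apply: contrapT => nV; apply: nW; exists x; split=> //; exists V => //.
  have Vx' x' y : V x' -> `|f (x, y) - f (x', y)| <= e / 2.
    move=> Vx'; rewrite leNgt; apply/negP => lt; apply: nV.
    by exists x'; split=> //; exists y.
  move=> x1 x2 y /(Vx' _ y) + /(Vx' _ y).
  by rewrite !ler_distl; lra.
have [FS _ _] := rF; have [_ _ sA] := FS _ FA.
have tA : has_tracking_tactic false (set_type A).
  exact/tracker_tracking_tactic/separable_has_tracker.
pose g (z : set_type A * Y) := f (set_val z.1, z.2).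
have gX y : continuous (fun z => g (z, y)).
  move=> z; apply: (@continuous_comp _ _ _ (set_val : set_type A -> X) (fun x => f (x, y))).
    exact: initial_continuous.
  exact: fX.
have [||z [Wz [V [B [[G oG GB] Bz] BV] VP]]] := @small_osc_nonmeager R _ Y g cY gX
    (fun x => fY (set_val x)) _ (set_val @^-1` W) (e / 2) tA e20.
- by exists W.
- by apply: (bF A FA); split; [exists W|exists (SigSub (mem_set Aw))].
rewrite -GB in Bz BV.
have oGW : open (G `&` W) by exact: openI.
have [d [Dd GWd]] := AD _ (set_valP z) _ (open_nbhs_nbhs (conj oGW (conj Bz Wz))).
have := clD 0%N d Dd _ (open_nbhs_nbhs (conj oGW GWd)).
move=> [x [[Ax]]]; rewrite /S; case: pselect => [_ [y dx] [Gx _]|]; last by case: GWd.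
have := VP (SigSub (mem_set (DA _ Dd))) (SigSub (mem_set Ax)) y.
rewrite leNgt dx => /(_ _ _)/negP; apply=> //; apply: BV => //=.
by case: GWd.
Qed.

(** * The zero-one law for tail sets *)

Section products.
Variables (I : eqType) (T : I -> topologicalType).
Local Notation PT := (prod_topology T).

Lemma continuous_prod (Z : topologicalType) (g : Z -> PT) :
  (forall i, continuous (fun z => g z i)) -> continuous g.
Proof.
move=> gi z; apply/cvg_sup => i A [B [[C oC <-] Cw] BA].
have : nbhs z ((fun z => g z i) @^-1` C).
  by apply: (gi i z); apply: open_nbhs_nbhs.
by apply: filterS => y Cy; apply: BA.
Qed.

(** All sides are constrained, also those outside the support, so that sides can
be combined freely and a good box has a point with all coordinates in them. *)
Definition good_box (B : seq I * (forall i, set (T i))) :=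
  forall i, nonvoid_open (B.2 i).

Lemma box_nonempty B : good_box B -> exists w, box B.1 B.2 w /\ forall i, B.2 i (w i).
Proof.
move=> gB; have B0 i : exists x, B.2 i x by have [] := gB i.
exists (fun i => projT1 (cid (B0 i))).
by split=> [i _|i]; exact: projT2 (cid (B0 i)).
Qed.

Lemma box_nonvoid_open B : good_box B -> nonvoid_open (box B.1 B.2).
Proof.
move=> gB; split; last by have [w [Bw _]] := @box_nonempty B gB; exists w.
by apply: open_box => i _; case: (gB i).
Qed.

Lemma box_in_open U : nonvoid_open U -> exists B, good_box B /\ box B.1 B.2 `<=` U.
Proof.
move=> [oU [x Ux]]; have [J [V [oV VU]]] := nbhs_box (open_nbhs_nbhs (conj oU Ux)).
by exists (J, V); split=> // i; have [oVi Vi] := oV i; split=> //; exists (x i).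
Qed.

Section tail.
Hypothesis cpb : forall i, exists2 B : set (set (T i)), countable B & pi_base B.

Section merge.
Variable J : seq I.

Definition merge (v x : PT) : PT := fun i => if i \in J then v i else x i.

Lemma merge_continuousl x : continuous (merge^~ x).
Proof.
apply: continuous_prod => i v; rewrite /merge; case: (i \in J).
  exact: (@proj_continuous _ T i v).
exact: (@cst_continuous PT (T i) (x i) v).
Qed.

Lemma merge_continuousr v : continuous (merge v).
Proof.
apply: continuous_prod => i x; rewrite /merge; case: (i \in J).
  exact: (@cst_continuous PT (T i) (v i) x).
exact: (@proj_continuous _ T i x).
Qed.

End merge.

Lemma pi_base_sequence (z : PT) : exists beta : forall i, nat -> set (T i),
  (forall i k, nonvoid_open (beta i k)) /\
  forall i U, nonvoid_open U -> exists k, beta i k `<=` U.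
Proof.
have H i : exists b : nat -> set (T i), (forall k, nonvoid_open (b k)) /\
    forall U, nonvoid_open U -> exists k, b k `<=` U.
  have [B /countable_injP[f finj] [BO Bpi]] := cpb i.
  exists (fun k => xget setT [set W | B W /\ f W = k]); split=> [k|U /Bpi[W BW WU]].
    case: xgetP => [W _ [/BO//]|_]; split; [exact: openT|by exists (z i)].
  exists (f W); case: xgetP => [W' _ [BW' fW]|/(_ W)/not_andP[]//].
  by rewrite (finj W' W (mem_set BW') (mem_set BW) fW).
exists (fun i => projT1 (cid (H i))).
by split=> i; have [] := projT2 (cid (H i)).
Qed.

(** For [x] in a residual set, the nowhere dense sets [N k] that cover
the part of the box outside [E] have nowhere dense sections: the set of all [u]
with [closure (N k) (merge J u x)] is nowhere dense.
Let such an [x] lie outside [E]. For [u] in the box, [merge J u x] is in the box,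
and it is outside [E] because it differs from [x] in finitely many coordinates.
So the sections cover the box, which would be meager. *)
Lemma tail_residual (E : set PT) (B : seq I * (forall i, set (T i))) :
  tail_set E -> good_box B -> ~ meager (box B.1 B.2) ->
  meager (box B.1 B.2 `\` E) -> residual E.
Proof.
move=> tE gB nB /meagerP[N [N0 BN]].
have [z [Bz _]] := @box_nonempty B gB; have [beta [obeta beta_pi]] := pi_base_sequence z.
set J := B.1 in nB BN Bz *.
(* The boxes [box J (V c)] form a countable pi-base of the factor of
   coordinates in [J]. *)
pose V (c : seq nat) i := beta i (nth 0%N c (index i J)).
pose S k c := [set x | exists2 v, box J (V c) v & ~ closure (N k) (merge J v x)].
have oS k c : open (S k c).
  rewrite (_ : S k c = \bigcup_(v in box J (V c)) (merge J v) @^-1` (~` closure (N k))).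
    apply: bigcup_open => v _; move: (@merge_continuousr J v) => /continuousP; apply.
    exact/closed_openC/closed_closure.
  by apply/seteqP; split=> x [v Vv nv]; exists v.
have dS k c U : nonvoid_open U -> U `&` S k c !=set0.
  move=> /box_in_open[[K W] [gW WU]].
  pose B' := (J ++ K, fun i => if i \in J then V c i else W i).
  have gB' : good_box B' by move=> i; rewrite /B' /=; case: ifP => _; [exact: obeta|exact: gW].
  have /nowhere_denseP/(_ _ (box_nonvoid_open gB'))[V' [[oV' [w V'w]] V'B V'N]] := N0 k.
  have Bw := V'B _ V'w; have [y [Wy _]] := @box_nonempty (K, W) gW.
  exists (merge J y w); split.
    apply: WU => j jK; rewrite /merge; case: ifP => jJ; first exact: Wy.
    by have := Bw j; rewrite /= mem_cat jK orbT jJ; apply.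
  exists w; first by move=> j jJ; have := Bw j; rewrite /= mem_cat jJ; apply.
  have -> : merge J w (merge J y w) = w.
    by apply: functional_extensionality_dep => i; rewrite /merge; case: ifP => // ->.
  exact: (notin_closure_open oV' V'N V'w).
have xS x : ~ E x -> exists k c, ~ S k c x.
  move=> nEx; apply: contrapT => nS.
  have xS k c : S k c x by apply: contrapT => nSk; apply: nS; exists k, c.
  apply: nB; apply/meagerP.
  exists (fun k => [set u | closure (N k) (merge J u x)]); split=> [k|u Bu]; last first.
    have [|k _ Nk] := BN (merge J u x).
      split; first by move=> j jJ; rewrite /merge jJ; exact: Bu.
      move=> Em; apply: nEx; apply/(tE _ _ _).1: Em.
      apply: sub_finite_set (finite_seq J) => i; apply: contra_notP => /negP iJ.
      by rewrite /merge (negPf iJ).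
    by exists k => //; exact: subset_closure.
  apply/nowhere_denseP => U oU; have [[K W] [gW WU]] := box_in_open oU.
  have /choice[c cP] : forall i, exists k, beta i k `<=` W i.
    by move=> i; exact: beta_pi.
  have [v Vv nv] := xS k (map c J).
  have [y [Wy _]] := @box_nonempty (K, W) gW.
  exists (U `&` (merge J)^~ x @^-1` (~` closure (N k))); split; last 2 first.
  - by move=> ? [].
  - by move=> ? [].
  split.
    apply: openI; first by case: oU.
    move: (@merge_continuousl J x) => /continuousP; apply.
    exact/closed_openC/closed_closure.
  exists (merge J v y); split.
    apply: WU => j jK; rewrite /merge; case: ifP => jJ; last exact: Wy.
    apply: cP; have := Vv j jJ.
    by rewrite /V (nth_map j) ?index_mem // nth_index.
  rewrite /= (_ : merge J (merge J v y) x = merge J v x) //.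
  by apply: functional_extensionality_dep => i; rewrite /merge; case: ifP => // ->.
apply: (@meagerS _ _ (\bigcup_k \bigcup_n (setT `\` S k (odflt [::] (choice.unpickle n))))).
  move=> x /xS[k [c nS]]; exists k => //; exists (choice.pickle c) => //.
  by rewrite choice.pickleK.
apply: meager_bigcup => k; apply: meager_bigcup => n; apply: nowhere_dense_meager.
by apply: nowhere_denseD => //; [exact: openT|move=> U oU _; exact: dS].
Qed.

(** If [E] is not meager, then [G] is not meager, and the Banach category
theorem gives a nonmeager box in [G], in which [E] is residual. *)
Lemma zero_one (E : set PT) : tail_set E -> property_of_Baire E ->
  meager E \/ residual E.
Proof.
move=> tE [G [P [oG mP EGP]]]; have [mE|nE] := pselect (meager E); first by left.
right; have [B [gB [BG nB]]] : exists B, good_box B /\ box B.1 B.2 `<=` G /\ ~ meager (box B.1 B.2).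
  apply: contrapT => nB; apply: nE.
  apply: (@meagerS _ _ (G `|` P)).
    by rewrite EGP => x [[Gx _]|[Px _]]; [left|right].
  apply: meagerU mP; apply: (@meager_of_local _ G
    [set W | exists2 B, good_box B & W = box B.1 B.2]) => // [V oV _|W [B gB ->] _ BG].
    have [B [gB BV]] := box_in_open oV; exists (box B.1 B.2); split=> //.
      by exists B.
    exact: box_nonvoid_open.
  by apply: contrapT => nm; apply: nB; exists B.
apply: (tail_residual tE gB nB); apply: meagerS mP => x [Bx nEx].
apply: contrapT => nPx; apply: nEx; rewrite EGP; left; split=> //; exact: BG.
Qed.

End tail.
End products.

(** * Products all of whose countable subproducts are Baire *)

Section countable_support.
Variables (I : eqType) (T : I -> topologicalType).
Local Notation PT := (prod_topology T).
Local Notation boxes := (seq I * (forall i, set (T i)))%type.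
Hypothesis sT : forall i, separable (T i).

Lemma dense_sequence (z : PT) : exists d : forall i, nat -> T i,
  forall i U, nonvoid_open U -> exists k, U (d i k).
Proof.
have H i : exists d : nat -> T i, forall U, nonvoid_open U -> exists k, U (d k).
  have [D /countable_injP[f finj] dD] := sT i.
  exists (fun k => xget (z i) [set x | D x /\ f x = k]) => U [oU U0].
  have [x [Ux Dx]] := dD U U0 oU; exists (f x).
  case: xgetP => [y _ [Dy fy]|/(_ x)/not_andP[]//].
  by rewrite (finj y x (mem_set Dy) (mem_set Dx) fy).
by exists (fun i => projT1 (cid (H i))) => i; exact: projT2 (cid (H i)).
Qed.

(** A closing-off argument that also shows that products of separable spaces
have the countable chain condition. For each finite list of coordinates in [K]
and each choice of values in the dense sequences, if some box of [Us n] admits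
these values, then the support of one such box is put into [K]. Every box [B]
of [Us n] then meets a box of [Us n] supported by [K]: choose values inside [B]
on those coordinates of [K] that [B] restricts; on all others at most one of the two
boxes imposes a condition. *)
Lemma countable_support (Us : nat -> set boxes) (z : PT) :
  (forall n, Us n `<=` @good_box I T) ->
  exists K : set I, countable K /\ forall n B, Us n B ->
    exists B', [/\ Us n B', [set` B'.1] `<=` K
                 & box B.1 B.2 `&` box B'.1 B'.2 !=set0].
Proof.
move=> gU; have [d dP] := dense_sequence z.
pose pt (l : seq I) (c : seq nat) : PT := fun i => d i (nth 0%N c (index i l)).
pose fits n l c (B : boxes) :=
  Us n B /\ forall j, j \in l -> j \in B.1 -> B.2 j (pt l c j).
have /choice[pick pickP] : forall nlc : nat * seq I * seq nat, exists J : seq I,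
    (exists B, fits nlc.1.1 nlc.1.2 nlc.2 B) ->
    exists2 B, fits nlc.1.1 nlc.1.2 nlc.2 B & J = B.1.
  move=> [[n l] c]; have [[B fB]|nB] := pselect (exists B, fits n l c B).
    by exists B.1 => _; exists B.
  by exists [::].
(* Countable sets of coordinates are unions of sequences of finite lists. A
   step keeps the old lists and adds, for [n], a finite union [flatten (map L r)]
   of old lists and values coded by [c], the support of the box picked for
   them. *)
pose step (L : nat -> seq I) (a : nat) : seq I := match choice.unpickle a with
  | Some (inl b) => L b
  | Some (inr (n, r, c)) => pick (n, flatten (map L r), c)
  | None => [::] end.
pose L k := iter k step (fun=> [::]).
pose Kk k := [set i | exists a, i \in L k a].
have KS k : Kk k `<=` Kk k.+1.
  move=> i [a ia]; exists (choice.pickle (inl a : nat + nat * seq nat * seq nat)).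
  by rewrite /L /= /step choice.pickleK.
have Kle k k' : (k <= k')%N -> Kk k `<=` Kk k'.
  by move=> /subnK <-; elim: (k' - k)%N => [//|m IH]; exact: subset_trans (KS _).
exists (\bigcup_k Kk k); split.
  apply: bigcup_countable => // k _.
  have -> : Kk k = \bigcup_a [set` L k a].
    by apply/seteqP; split=> i [a]; [exists a|move=> _ ?; exists a].
  by apply: bigcup_countable => // a _; exact/finite_set_countable/finite_seq.
move=> n [J V] UB /=; have gB := gU _ _ UB.
set K := \bigcup_k Kk k.
have [k0 _ k0P] : \forall k \near \oo, forall j, j \in J -> K j -> Kk k j.
  apply: filter_forall_seq => j _; have [[k _ kj]|nK] := pselect (K j).
    by exists k => // k' /= kk' _; exact: Kle kk' _ kj.
  by exists 0%N.
have {k0P} kP := k0P k0 (leqnn _).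
have /choice[a aP] : forall j, exists a, j \in J -> K j -> j \in L k0 a.
  move=> j; have [jJ|jJ] := boolP (j \in J); last by exists 0%N.
  have [Kj|nK] := pselect (K j); last by exists 0%N.
  by have [a aj] := kP j jJ Kj; exists a.
pose l := flatten (map (L k0) (map a J)).
have Jl j : j \in J -> K j -> j \in l.
  move=> jJ Kj; apply/flattenP; exists (L k0 (a j)); last exact: aP.
  by apply: map_f; exact: map_f.
have /choice[c cP] : forall j, exists c, V j (d j c).
  by move=> j; apply: dP; exact: gB.
have ptV j : j \in l -> V j (pt l (map c l) j).
  by move=> jl; rewrite /pt (nth_map j) ?index_mem // nth_index.
have [|[J' V'] [UB' fB'] JE] := pickP (n, l, map c l).
  by exists (J, V); split=> // j jl _; exact: ptV.
have J'K : [set` J'] `<=` K.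
  move=> j jJ'; exists k0.+1 => //.
  exists (choice.pickle (inr (n, map a J, map c l) : nat + nat * seq nat * seq nat)).
  by rewrite /L /= /step choice.pickleK -/(L k0) -/l JE.
exists (J', V'); split=> //.
have [w [_ Vw]] := @box_nonempty I T (J, V) gB.
have [w' [_ Vw']] := @box_nonempty I T (J', V') (gU _ _ UB').
exists (fun i => if i \in l then pt l (map c l) i else if i \in J then w i else w' i).
split=> j jB /=; case: ifP => jl.
- exact: ptV.
- by rewrite jB; exact: Vw.
- exact: fB'.
- case: ifP => jJ; last exact: Vw'.
  by have := Jl j jJ (J'K _ jB); rewrite jl.
Qed.

Section extension.
Variables (K : set I) (z : PT).
Local Notation PK := (prod_topology (fun j : set_type K => T (set_val j))).

Definition extend (x : PK) : PT := fun i =>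
  if pselect (K i) is left Ki then x (SigSub (mem_set Ki)) else z i.

Definition restrict (w : PT) : PK := fun j => w (set_val j).

Lemma extend_continuous : continuous extend.
Proof.
apply: continuous_prod => i x; rewrite /extend; case: pselect => [Ki|_].
  exact: (@proj_continuous (set_type K) (fun j => T (set_val j)) (SigSub (mem_set Ki)) x).
exact: (@cst_continuous PK (T i) (z i) x).
Qed.

Lemma restrict_continuous : continuous restrict.
Proof.
apply: (@continuous_prod (set_type K) (fun j => T (set_val j))) => j.
exact: (@proj_continuous _ T (set_val j)).
Qed.

Lemma extend_restrict w i : K i -> extend (restrict w) i = w i.
Proof. by move=> Ki; rewrite /extend /restrict; case: pselect. Qed.

Lemma extendK x : restrict (extend x) = x.
Proof.
apply: functional_extensionality_dep => -[i iK]; rewrite /restrict /extend /=.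
case: pselect => [Ki|]; last by case; exact: set_mem iK.
by rewrite (bool_irrelevance (mem_set Ki) iK).
Qed.

End extension.

(** Let [K] be closed off for the boxes disjoint from the nowhere dense sets
[N n]. For each [n], the union of those boxes disjoint from [N n] that are
supported by [K] has a dense open trace on the subproduct. The complements of
these traces are nowhere dense and cover the trace of [U]. *)
Lemma meager_countable_factor (U : set PT) (z : PT) : open U -> U z -> meager U ->
  exists K : set I, countable K /\
    nonvoid_open (@extend K z @^-1` U) /\ meager (@extend K z @^-1` U).
Proof.
move=> oU Uz [N [N0 UN]].
pose Us n := [set B : boxes | good_box B /\ forall x, box B.1 B.2 x -> ~ N n x].
have [|K [cK KP]] := @countable_support Us z; first by move=> n B [].
have Kext B w : [set` B.1] `<=` K ->
    box B.1 B.2 w -> box B.1 B.2 (extend z (restrict (K := K) w)).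
  by move=> BK Bw j jB; rewrite extend_restrict; [exact: Bw|exact: BK].
exists K; split=> //; split.
  split.
    by move: (@extend_continuous K z) => /continuousP; apply.
  exists (restrict z); rewrite /=.
  suff -> : extend z (restrict (K := K) z) = z by [].
  apply: functional_extensionality_dep => i.
  have [Ki|nK] := pselect (K i); first exact: extend_restrict.
  by rewrite /extend; case: pselect.
apply/meagerP.
exists (fun n => [set x | forall B, Us n B -> [set` B.1] `<=` K ->
                    ~ box B.1 B.2 (extend z x)]); split; last first.
  move=> x; rewrite /= UN => -[n _ Nx]; exists n => // B [_ BN] _ Bx.
  exact: BN Bx Nx.
move=> n; apply/nowhere_denseP => W [oW [x0 Wx0]].
have oW' : nonvoid_open (@restrict K @^-1` W).
  split; first by move: (@restrict_continuous K) => /continuousP; apply.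
  by exists (extend z x0); rewrite /= extendK.
have /nowhere_denseP/(_ _ oW')[V [oV VW VN]] := N0 n.
have [B [gB BV]] := box_in_open oV.
have [|B' [[gB' B'N] B'K [w [Bw B'w]]]] := KP n B.
  by split=> // x /BV; exact: VN.
exists (W `&` @extend K z @^-1` box B'.1 B'.2); split.
- split.
    apply: openI => //; move: (@extend_continuous K z) => /continuousP; apply.
    by have [] := box_nonvoid_open gB'.
  by exists (restrict w); split; [exact: (VW w (BV _ Bw))|exact: Kext].
- by move=> ? [].
- by move=> x [_ B'x] /(_ B' (conj gB' B'N) B'K).
Qed.

Lemma product_baire : (forall K : set I, countable K ->
    baire_space (prod_topology (fun j : set_type K => T (set_val j)))) ->
  baire_space PT.
Proof.
move=> bK U [oU [z Uz]] mU.
have [K [cK [oE mE]]] := meager_countable_factor oU Uz mU.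
exact: bK oE mE.
Qed.

Lemma product_nonmeager : (forall K : set I, countable K ->
    nonmeager_space (prod_topology (fun j : set_type K => T (set_val j)))) ->
  nonmeager_space PT.
Proof.
move=> nK mT.
have T0 i : exists x : T i, True.
  have [x _] := nonmeager_nonempty (nK [set i] (countable1 i)).
  by exists (x (SigSub (mem_set (erefl i : [set i] i)))).
pose z : PT := fun i => projT1 (cid (T0 i)).
have [K [cK [_ mE]]] := @meager_countable_factor setT z openT Logic.I mT.
exact: nK mE.
Qed.

End countable_support.

(** * Namioka and Baire properties of product spaces *)

Theorem mainTheorem1 (R : realType) :
  (* (1) *)
  (forall (I : Type) (T : I -> topologicalType) (X : set (prod_topology T)),
     (forall i, separable (T i)) -> open X ->
     (nonmeager_space (set_type X) -> gN_space R (set_type X)) /\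
     (baire_space (set_type X) -> N_space R (set_type X))) /\
  (* (2) *)
  (forall (I : Type) (T : I -> pseudoMetricType R)
     (X : set (prod_topology (fun i => T i : topologicalType))),
     open X ->
     (baire_space (set_type X) <->
        tau_well_beta_defavorable (set_type X)) /\
     (nonmeager_space (set_type X) <-> gN_space R (set_type X))) /\
  (* (3) *)
  (forall (X : topologicalType) (Y : pseudoMetricType R),
     separable X ->
     (baire_space (X * Y)%type -> N_space R (X * Y)%type) /\
     (nonmeager_space (X * Y)%type -> gN_space R (X * Y)%type)) /\
  (* (4) *)
  (forall X : topologicalType,
     countably_tight X ->
     (exists F : set (set X), rich_family F /\
        forall A, F A -> baire_space (set_type A)) ->
     N_space R X) /\
  (* (5) *)
  (forall (I : Type) (T : I -> topologicalType),
     (forall i, separable (T i)) ->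
     ((forall J : set I, countable J ->
         baire_space (prod_topology (fun j : set_type J => T (set_val j)))) ->
      baire_space (prod_topology T) /\ N_space R (prod_topology T)) /\
     ((forall J : set I, countable J ->
         nonmeager_space (prod_topology (fun j : set_type J => T (set_val j)))) ->
      nonmeager_space (prod_topology T) /\ gN_space R (prod_topology T))) /\
  (* (6) *)
  (forall (I : Type) (T : I -> topologicalType),
     (forall i, exists2 B : set (set (T i)), countable B & pi_base B) ->
     forall E : set (prod_topology T), tail_set E -> property_of_Baire E ->
     meager E \/ residual E) /\
  (* (7) *)
  (forall X : topologicalType,
     completely_regular R X -> gN_space R X -> nonmeager_space X) /\
  (forall X Y : topologicalType,
     completely_regular R (X * Y)%type ->
     (separable X \/ pseudo_metrizable R X) ->
     (separable Y \/ pseudo_metrizable R Y) ->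
     (baire_space (X * Y)%type <-> N_space R (X * Y)%type) /\
     (nonmeager_space (X * Y)%type <-> gN_space R (X * Y)%type)).
Proof.
split; last split; last split; last split; last split; last split; last split.
- move=> I T X sT oX.
  have tX : has_tracking_tactic false (set_type X).
    apply: (@product_tracking_tactic {classic I} T _ set_val) => [i|].
      exact: separable_has_tracker.
    exact: (@open_embedding_set_val {classic I}).
  by split; [exact: tracking_tactic_gN_space tX|exact: tracking_tactic_N_space tX].
- move=> I T X oX.
  have tX : has_tracking_tactic true (set_type X).
    apply: (@product_tracking_tactic {classic I} T _ set_val) => [i|].
      exact: pseudometric_has_tracker.
    exact: (@open_embedding_set_val {classic I}).
  split; split.
  + exact: tracking_tactic_tau_well.
  + exact: tau_well_baire.
  + exact: tracking_tactic_gN_space tX.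
  + exact/completely_regular_gN_nonmeager/completely_regular_subspace.
- move=> X Y sX; have tXY : has_tracking_tactic false (X * Y)%type.
    apply/tracker_tracking_tactic/has_tracker_prod; first exact: separable_has_tracker.
    exact: pseudometric_has_tracker.
  by split; [exact: tracking_tactic_N_space tXY|exact: tracking_tactic_gN_space tXY].
- by move=> X tX [F [rF bF]]; exact: rich_N_space tX rF bF.
- move=> I T sT.
  have tT : has_tracking_tactic false (prod_topology T).
    apply: (@product_tracking_tactic {classic I} T _ id) => [i|].
      exact: separable_has_tracker.
    exact: (@open_embedding_id {classic I}).
  split=> [bJ|nJ].
    have bT := @product_baire {classic I} T sT bJ.
    by split=> //; exact: tracking_tactic_N_space tT bT.
  have nT := @product_nonmeager {classic I} T sT nJ.
  by split=> //; exact: tracking_tactic_gN_space tT nT.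
- by move=> I T cpb E tE bE; exact: (@zero_one {classic I} T cpb E tE bE).
- exact: completely_regular_gN_nonmeager.
- move=> X Y crXY fX fY.
  have tracker_of (T : topologicalType) :
      separable T \/ pseudo_metrizable R T -> has_tracker false T.
    by case; [exact: separable_has_tracker|exact: pseudo_metrizable_has_tracker].
  have tXY : has_tracking_tactic false (X * Y)%type.
    by apply/tracker_tracking_tactic/has_tracker_prod; exact: tracker_of.
  split; split.
  + exact: tracking_tactic_N_space tXY.
  + exact: completely_regular_N_baire.
  + exact: tracking_tactic_gN_space tXY.
  + exact: completely_regular_gN_nonmeager.
Qed.
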